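(* Let $\underline{G}=(G_1,\dots,G_m)$ be a sequence of discrete groups and let $K$ be a flag simplicial complex on the vertex set $[m]$. For each $J\subset[m]$, choose a set $\mathrm{Gen}(J)$ of cycles $\lambda=(i_1,\dots,i_k,i_{k+1}=i_1)$ in $K_J$ such that their images generate the group $\Pi_1(K_J)$. Then the group $\mathrm{Cart}(\underline{G},K)$ is presented by the $\sum_{J\subset[m]}\widetilde b_0(K_J)\cdot n_J$ generators $$\widehat D=\Big\{\widehat L_{\underline g}(i,J):\ J\subset[m],\ \underline g\in\prod_{j\in J}G_j^*,\ i\in\Theta(J)\Big\}$$ modulo the $\sum_{J\subset[m]}|\mathrm{Gen}(J)|\cdot n_J$ relations $$\Big\{\mathrm{Red}(R_{\underline g}(\lambda,J))=1:\ J\subset[m],\ \underline g\in\prod_{j\in J}G_j^*,\ \lambda\in\mathrm{Gen}(J)\Big\}.$$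
   Context: **Complexes and groups.** A simplicial complex $K$ on $[m]=\{1,\dots,m\}$ is a collection of subsets of $[m]$, closed under taking subsets, containing $\varnothing$ and all singletons. It is flag if $I\in K$ whenever $\{i,j\}\in K$ for all $i,j\in I$. $K_J=\{I\in K:I\subset J\}$; topological notions applied to $K_J$ refer to its geometric realization. The graph product is $\underline{G}^K=(G_1\ast\dots\ast G_m)/(g_ig_j=g_jg_i$ for $i\ne j$, $\{i,j\}\in K$, $g_i\in G_i$, $g_j\in G_j)$, and $\mathrm{Cart}(\underline{G},K)=\ker(\underline{G}^K\to\prod_iG_i)$. $G_j^*:=G_j\setminus\{1_j\}$, $n_J:=\prod_{j\in J}|G_j^*|$, $\widetilde b_0(X)=\dim_{\mathbb Q}\widetilde H_0(X;\mathbb Q)$ ($\widetilde b_0(\varnothing)=0$). $\Pi_1(X)$ is the free product of the fundamental groups of the path components of $X$. **Generators.** For each non-empty $J\subset[m]$ a subset $\Theta(J)\subset J\setminus\{\max(J)\}$ is fixed such that $\Theta(J)\sqcup\{\max(J)\}$ contains exactly one vertex from each path component of $|K_J|$; $\Theta(\varnothing)=\varnothing$. For $i\in J\subset[m]$ and $\underline g=(g_j)_{j\in J}\in\prod_{j\in J}G_j^*$ let $$L_{\underline g}(i,J)=\prod_{j\in J}g_j\cdot g_i^{-1}\cdot\Big(\prod_{j\in J\setminus\{i\}}g_j\Big)^{-1}\in\mathrm{Cart}(\underline{G},K),$$ products in ascending order of indices. For $J'\subset J$, $L_{\underline g}(i,J')$ means $L_{\underline g|_{J'}}(i,J')$. Let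 $D$ be the set of all $L_{\underline g}(i,J)$ and $\widehat D\subset D$ the set of those with $i\in\Theta(J)$ (then written $\widehat L_{\underline g}(i,J)$). In the free groups $F(D)$ and $F(\widehat D)$ these are regarded as formal letters indexed by $(i,J,\underline g)$. **Reduction.** $\mathrm{Red}:F(D)\to F(\widehat D)$ is the homomorphism defined on letters by recursion on $|J|$: given $i\in J$, let $i'$ be the unique element of $\Theta(J)\sqcup\{\max(J)\}$ in the path component of $i$ in $K_J$, and fix a path $i=i_0,i_1,\dots,i_k=i'$ in $K_J$ (edges $\{i_t,i_{t+1}\}\in K_J$, $i_t\neq i_{t+1}$; $k=0$ if $i=i'$), the choice depending only on $(i,J)$ (e.g. a lexicographically minimal one). Put $\epsilon=\widehat L_{\underline g}(i',J)$ if $i'\in\Theta(J)$ and $\epsilon=1$ if $i'=\max(J)$. Then $$\mathrm{Red}(L_{\underline g}(i,J))=\epsilon\cdot\prod_{t=k-1,\,k-2,\dots,0}\mathrm{Red}\big(L_{\underline g}(i_t,J\setminus\{i_{t+1}\})\big)\cdot\mathrm{Red}\big(L_{\underline g}(i_{t+1},J\setminus\{i_t\})\big)^{-1},$$ the factors being written from left to right in decreasing order of $t$. (This repeatedly applies the relation $L_{\underline g}(i,J)L_{\underline g}(j,J\setminus\{i\})=L_{\underline g}(j,J)L_{\underline g}(i,J\setminus\{j\})$ for edges $\{i,j\}\in K_J$, and $L_{\underline g}(\max(J),J)=1$.) **Relations.** A cycle in $K_J$ is a sequence $\lambda=(i_1,\dots,i_k,i_{k+1}=i_1)$ of vertices of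 $J$ with edges $\{i_t,i_{t+1}\}\in K_J$, $i_t\ne i_{t+1}$, $t=1,\dots,k$. For such $\lambda$ and $\underline g\in\prod_{j\in J}G_j^*$, $$R_{\underline g}(\lambda,J)=\prod_{t=1}^kL_{\underline g}(i_{t+1},J\setminus\{i_t\})\cdot L_{\underline g}(i_t,J\setminus\{i_{t+1}\})^{-1}\in F(D)$$ (factors in increasing order of $t$). ''The images of the cycles in $\mathrm{Gen}(J)$ generate $\Pi_1(K_J)$'' means: in each path component of $|K_J|$ a base vertex is fixed, the cycles of $\mathrm{Gen}(J)$ in this component start at this vertex, and their homotopy classes generate the fundamental group of the component. *)

(* Defs.v *)
From HB Require Import structures.
From mathcomp Require Import all_boot generic_quotient all_order all_algebra.
From mathcomp Require Import all_classical reals topology normedtype.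

Set Implicit Arguments.
Unset Strict Implicit.
Unset Printing Implicit Defensive.

Import Order.TTheory GRing.Theory Num.Theory.
Import numFieldNormedType.Exports.

Local Open Scope quotient_scope.
Local Open Scope classical_set_scope.

Section FreeGroup.
Local Open Scope group_scope.
Variable X : choiceType.

(* A letter [(x, b)] is [x] if [b] is true and [x^-1] if [b] is false. *)
Definition fg_word := seq (X * bool).

Inductive fg_rel : fg_word -> fg_word -> Prop :=
| fg_rel_refl u : fg_rel u u
| fg_rel_sym u v : fg_rel u v -> fg_rel v u
| fg_rel_trans v u w : fg_rel u v -> fg_rel v w -> fg_rel u w
| fg_rel_cancel u v x b : fg_rel (u ++ (x, b) :: (x, ~~ b) :: v) (u ++ v).

Definition fg_eqv (u v : fg_word) : bool := `[< fg_rel u v >].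

Fact fg_eqv_refl : reflexive fg_eqv.
Proof. by move=> u; apply/asboolP; exact: fg_rel_refl. Qed.
Fact fg_eqv_sym : symmetric fg_eqv.
Proof. by move=> u v; apply/asboolP/asboolP; exact: fg_rel_sym. Qed.
Fact fg_eqv_trans : transitive fg_eqv.
Proof.
by move=> v u w /asboolP uv /asboolP vw; apply/asboolP; exact: fg_rel_trans vw.
Qed.

Definition fg_equiv := EquivRel fg_eqv fg_eqv_refl fg_eqv_sym fg_eqv_trans.
Definition free_group := {eq_quot fg_equiv}.
HB.instance Definition _ := Choice.on free_group.
HB.instance Definition _ := EqQuotient.on free_group.

Definition fg_class (u : fg_word) : free_group := \pi_free_group u.

Lemma fg_classP u v : fg_class u = fg_class v <-> fg_rel u v.
Proof.
rewrite /fg_class; split=> [/eqP|uv].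
  by rewrite eqmodE => /asboolP.
by apply/eqP; rewrite eqmodE; apply/asboolP.
Qed.

Lemma fg_classK (w : free_group) : fg_class (repr w) = w.
Proof. exact: reprK. Qed.

Lemma fg_relM u u' v v' :
  fg_rel u u' -> fg_rel v v' -> fg_rel (u ++ v) (u' ++ v').
Proof.
move=> uu' vv'; apply: (@fg_rel_trans (u' ++ v)).
  elim: uu' => {u u'} [u|u w _|w u z _ + _|u z x b].
  - exact: fg_rel_refl.
  - exact: fg_rel_sym.
  - exact: fg_rel_trans.
  - by rewrite -!catA /=; exact: fg_rel_cancel.
elim: vv' => {v v'} [v|v w _|w v z _ + _|v z x b].
- exact: fg_rel_refl.
- exact: fg_rel_sym.
- exact: fg_rel_trans.
- by rewrite !catA; exact: fg_rel_cancel.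
Qed.

Definition fg_winv (u : fg_word) : fg_word := rev [seq (a.1, ~~ a.2) | a <- u].

Lemma fg_winvK : involutive fg_winv.
Proof.
move=> u; rewrite /fg_winv map_rev revK -map_comp -[RHS]map_id.
by apply: eq_map => -[x b] /=; rewrite negbK.
Qed.

Lemma fg_relV u v : fg_rel u v -> fg_rel (fg_winv u) (fg_winv v).
Proof.
elim=> {u v} [u|u w _|w u z _ + _|u z x b].
- exact: fg_rel_refl.
- exact: fg_rel_sym.
- exact: fg_rel_trans.
rewrite /fg_winv !map_cat !rev_cat /= negbK !rev_cons -!cats1 -!catA /=.
exact: fg_rel_cancel.
Qed.

Lemma fg_relVl u : fg_rel (fg_winv u ++ u) [::].
Proof.
elim: u => [|[x b] u IH]; first exact: fg_rel_refl.
rewrite /fg_winv /= rev_cons -cats1 -catA /=.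
apply: fg_rel_trans IH.
by have := fg_rel_cancel (fg_winv u) u x (~~ b); rewrite negbK.
Qed.

Definition fg_one : free_group := fg_class [::].
Definition fg_mul (v w : free_group) : free_group :=
  fg_class (repr v ++ repr w).
Definition fg_inv (w : free_group) : free_group := fg_class (fg_winv (repr w)).

Lemma fg_mulE u v : fg_mul (fg_class u) (fg_class v) = fg_class (u ++ v).
Proof. by apply/fg_classP/fg_relM; apply/fg_classP; rewrite fg_classK. Qed.
Lemma fg_invE u : fg_inv (fg_class u) = fg_class (fg_winv u).
Proof. by apply/fg_classP/fg_relV/fg_classP; rewrite fg_classK. Qed.

Fact fg_mulA : associative fg_mul.
Proof.
move=> u v w; rewrite -[u]fg_classK -[v]fg_classK -[w]fg_classK.
by rewrite !fg_mulE catA.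
Qed.
Fact fg_mul1 : left_id fg_one fg_mul.
Proof. by move=> u; rewrite -[u]fg_classK fg_mulE. Qed.
Fact fg_1mul : right_id fg_one fg_mul.
Proof. by move=> u; rewrite -[u]fg_classK fg_mulE cats0. Qed.
Fact fg_mulV : left_inverse fg_one fg_inv fg_mul.
Proof.
move=> u; rewrite -[u]fg_classK fg_invE fg_mulE.
by apply/fg_classP/fg_relVl.
Qed.
Fact fg_Vmul : right_inverse fg_one fg_inv fg_mul.
Proof.
move=> u; rewrite -[u]fg_classK fg_invE fg_mulE; apply/fg_classP.
by rewrite -{1}[repr u]fg_winvK; exact: fg_relVl.
Qed.

HB.instance Definition _ := isGroup.Build free_group
  fg_mulA fg_mul1 fg_1mul fg_mulV fg_Vmul.

Definition fg_gen (x : X) : free_group := fg_class [:: (x, true)].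

Lemma fg_class_cons x b u :
  fg_class ((x, b) :: u) = (if b then fg_gen x else (fg_gen x)^-1) * fg_class u.
Proof.
have -> : (if b then fg_gen x else (fg_gen x)^-1) = fg_class [:: (x, b)].
  by case: b => //; rewrite /fg_gen [LHS]fg_invE.
by rewrite [RHS]fg_mulE.
Qed.

Section Lift.
Variables (H : groupType) (f : X -> H).

Definition fg_eval (u : fg_word) : H :=
  \prod_(a <- u) (if a.2 then f a.1 else (f a.1)^-1).

Definition fg_lift (w : free_group) : H := fg_eval (repr w).

Lemma fg_eval_rel u v : fg_rel u v -> fg_eval u = fg_eval v.
Proof.
elim=> {u v} // [w u z _ -> _ ->//|u v x b].
rewrite /fg_eval !big_cat !big_cons /=; congr (_ * _).
by rewrite mulgA; case: b => /=; rewrite ?mulgV ?mulVg mul1g.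
Qed.

Lemma fg_lift_class u : fg_lift (fg_class u) = fg_eval u.
Proof. by apply/fg_eval_rel/fg_classP; rewrite fg_classK. Qed.

Lemma fg_lift_gen x : fg_lift (fg_gen x) = f x.
Proof. by rewrite /fg_gen fg_lift_class /fg_eval big_seq1. Qed.

Fact fg_lift_morphM : {morph fg_lift : v w / v * w}.
Proof.
move=> v w; rewrite -[v]fg_classK -[w]fg_classK.
by rewrite [X in fg_lift X]fg_mulE !fg_lift_class /fg_eval big_cat.
Qed.
Fact fg_lift_morph1 : fg_lift 1 = 1.
Proof. by rewrite [LHS]fg_lift_class /fg_eval big_nil. Qed.
HB.instance Definition _ := isUMagmaMorphism.Build free_group H fg_lift
  (conj fg_lift_morph1 fg_lift_morphM).
End Lift.

End FreeGroup.

Section NormalClosure.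
Local Open Scope group_scope.
Variables (H : groupType) (R : set H).

Inductive normal_closure : set H :=
| ncl_gen x of R x : normal_closure x
| ncl_one : normal_closure 1
| ncl_mul x y of normal_closure x & normal_closure y : normal_closure (x * y)
| ncl_inv x of normal_closure x : normal_closure x^-1
| ncl_conj x y of normal_closure x : normal_closure (x ^ y).

Definition ncl_eqv (x y : H) : bool := `[< normal_closure (x^-1 * y) >].

Fact ncl_eqv_refl : reflexive ncl_eqv.
Proof. by move=> x; apply/asboolP; rewrite mulVg; exact: ncl_one. Qed.
Fact ncl_eqv_sym : symmetric ncl_eqv.
Proof.
have sub x y : ncl_eqv x y -> ncl_eqv y x.
  by move=> /asboolP/ncl_inv; rewrite invgM invgK => xy; exact/asboolP.
by move=> x y; apply/idP/idP; exact: sub.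
Qed.
Fact ncl_eqv_trans : transitive ncl_eqv.
Proof.
move=> y x z /asboolP xy /asboolP yz; apply/asboolP.
by have := ncl_mul xy yz; rewrite -mulgA mulVKg.
Qed.

Definition ncl_equiv := EquivRel ncl_eqv ncl_eqv_refl ncl_eqv_sym ncl_eqv_trans.
Definition quot_group := {eq_quot ncl_equiv}.
HB.instance Definition _ := Choice.on quot_group.
HB.instance Definition _ := EqQuotient.on quot_group.

Definition quot_proj (x : H) : quot_group := \pi_quot_group x.

Lemma quot_projP x y :
  quot_proj x = quot_proj y <-> normal_closure (x^-1 * y).
Proof.
rewrite /quot_proj; split=> [/eqP|xy].
  by rewrite eqmodE => /asboolP.
by apply/eqP; rewrite eqmodE; apply/asboolP.
Qed.

Lemma quot_projK (x : quot_group) : quot_proj (repr x) = x.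
Proof. exact: reprK. Qed.

Definition quot_one : quot_group := quot_proj 1.
Definition quot_mul (x y : quot_group) : quot_group :=
  quot_proj (repr x * repr y).
Definition quot_inv (x : quot_group) : quot_group := quot_proj (repr x)^-1.

Lemma quot_mulE x y : quot_mul (quot_proj x) (quot_proj y) = quot_proj (x * y).
Proof.
apply/quot_projP; rewrite invgM.
have xx' : normal_closure ((repr (quot_proj x))^-1 * x).
  by apply/quot_projP; rewrite quot_projK.
have yy' : normal_closure ((repr (quot_proj y))^-1 * y).
  by apply/quot_projP; rewrite quot_projK.
have := ncl_mul yy' (ncl_conj y xx').
by rewrite conjgE -!mulgA mulVKg.
Qed.
Lemma quot_invE x : quot_inv (quot_proj x) = quot_proj x^-1.
Proof.
apply/quot_projP; rewrite invgK.
have /ncl_inv : normal_closure ((repr (quot_proj x))^-1 * x).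
  by apply/quot_projP; rewrite quot_projK.
move=> /(ncl_conj x^-1); rewrite conjgE invgM !invgK -!mulgA.
by rewrite mulVKg.
Qed.

Fact quot_mulA : associative quot_mul.
Proof.
move=> x y z; rewrite -[x]quot_projK -[y]quot_projK -[z]quot_projK.
by rewrite !quot_mulE mulgA.
Qed.
Fact quot_mul1 : left_id quot_one quot_mul.
Proof. by move=> x; rewrite -[x]quot_projK quot_mulE mul1g. Qed.
Fact quot_1mul : right_id quot_one quot_mul.
Proof. by move=> x; rewrite -[x]quot_projK quot_mulE mulg1. Qed.
Fact quot_mulV : left_inverse quot_one quot_inv quot_mul.
Proof. by move=> x; rewrite -[x]quot_projK quot_invE quot_mulE mulVg. Qed.
Fact quot_Vmul : right_inverse quot_one quot_inv quot_mul.
Proof. by move=> x; rewrite -[x]quot_projK quot_invE quot_mulE mulgV. Qed.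

HB.instance Definition _ := isGroup.Build quot_group
  quot_mulA quot_mul1 quot_1mul quot_mulV quot_Vmul.

Fact quot_proj_morphM : {morph quot_proj : x y / x * y}.
Proof. by move=> x y; exact/esym/quot_mulE. Qed.
HB.instance Definition _ := isUMagmaMorphism.Build H quot_group quot_proj
  (conj erefl quot_proj_morphM).

(* The map induced by [f], which is meaningful when [f] is trivial on [R]. *)
Definition quot_lift (H' : groupType) (f : H -> H') (x : quot_group) : H' :=
  f (repr x).

Lemma quot_lift_proj (H' : groupType) (f : UMagmaMorphism.type H H') x :
  (forall r, R r -> f r = 1) -> quot_lift f (quot_proj x) = f x.
Proof.
move=> fR.
have f1 y : normal_closure y -> f y = 1.
  elim=> {y} [y /fR//||y z _ fy _ fz|y _ fy|y z _ fy].
  - exact: gmulf1.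
  - by rewrite gmulfM fy fz mulg1.
  - by rewrite gmulfV fy invg1.
  - by rewrite gmulfJ fy conj1g.
have /f1 : normal_closure ((repr (quot_proj x))^-1 * x).
  by apply/quot_projP; rewrite quot_projK.
by rewrite gmulfM gmulfV => /mulg1_eq; rewrite invgK.
Qed.

Lemma quot_lift_morphM (H' : groupType) (f : UMagmaMorphism.type H H') :
  (forall r, R r -> f r = 1) -> {morph quot_lift f : x y / x * y}.
Proof.
move=> fR x y; rewrite -[x in LHS]quot_projK -[y in LHS]quot_projK.
by rewrite -gmulfM quot_lift_proj // gmulfM.
Qed.

End NormalClosure.

(* [S] is the subgroup of [H] presented by the generators [f x], [x : X],
   modulo the relations [r = 1], [r] in [R]. *)
Definition presented_by (H : groupType) (S : set H) (X : choiceType)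
    (f : X -> H) (R : set (free_group X)) : Prop :=
  range (fg_lift f) = S /\ [set w | fg_lift f w = 1%g] = normal_closure R.

(* The vertex set is ['I_m], that is, {0, ..., m - 1} instead of {1, ..., m}. *)
Definition simplicial_complex (m : nat) (K : {set {set 'I_m}}) : Prop :=
  [/\ finset.set0 \in K,
      forall i, [set i]%SET \in K &
      forall I J : {set 'I_m}, I \in K -> J \subset I -> J \in K].

Definition flag_complex (m : nat) (K : {set {set 'I_m}}) : Prop :=
  forall I : {set 'I_m},
    (forall i j, i \in I -> j \in I -> [set i; j]%SET \in K) -> I \in K.

Definition restriction (m : nat) (K : {set {set 'I_m}}) (J : {set 'I_m}) :
  {set {set 'I_m}} := [set I in K | I \subset J]%SET.

Definition edge (m : nat) (K : {set {set 'I_m}}) : rel 'I_m :=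
  fun i j => (i != j) && ([set i; j]%SET \in K).

Section GraphProduct.
Local Open Scope group_scope.
Variables (m : nat) (G : 'I_m -> groupType) (K : {set {set 'I_m}}).

(* The disjoint union of the [G i]; [existT _ i g] is [g] viewed in [G i]. *)
Definition factors : choiceType := {i : 'I_m & G i}.
Definition factor (i : 'I_m) (g : G i) : factors := existT _ i g.

(* The multiplication tables of the [G i] present their free product. *)
Definition free_product_rels : set (free_group factors) :=
  [set r | exists i (g h : G i),
     r = fg_gen (factor g) * fg_gen (factor h) * (fg_gen (factor (g * h)))^-1].
Definition free_product : groupType := quot_group free_product_rels.
Definition fp_in (i : 'I_m) (g : G i) : free_product :=
  quot_proj free_product_rels (fg_gen (factor g)).

Definition graph_product_rels : set free_product :=
  [set r | exists i j (g : G i) (h : G j),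
     edge K i j /\ r = fp_in g * fp_in h * (fp_in h * fp_in g)^-1].
Definition graph_product : groupType := quot_group graph_product_rels.
Definition gp_in (i : 'I_m) (g : G i) : graph_product :=
  quot_proj graph_product_rels (fp_in g).

Lemma fp_inM i (g h : G i) : fp_in (g * h) = fp_in g * fp_in h.
Proof.
rewrite /fp_in -gmulfM; apply/esym/quot_projP; rewrite invgM.
have /ncl_inv : normal_closure free_product_rels
    (fg_gen (factor g) * fg_gen (factor h) * (fg_gen (factor (g * h)))^-1).
  by apply: ncl_gen; exists i, g, h.
move=> /(ncl_conj (fg_gen (factor (g * h))))/ncl_inv.
rewrite conjgE !invgM !invgK -!mulgA mulVg mulg1 => /ncl_inv.
by rewrite !invgM !invgK -!mulgA.
Qed.

Lemma gp_inM i (g h : G i) : gp_in (g * h) = gp_in g * gp_in h.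
Proof. by rewrite /gp_in fp_inM gmulfM. Qed.

Lemma gp_in_comm i j (g : G i) (h : G j) : edge K i j ->
  gp_in g * gp_in h = gp_in h * gp_in g.
Proof.
move=> ij; apply/divg1_eq.
transitivity (quot_proj graph_product_rels
    (fp_in g * fp_in h * (fp_in h * fp_in g)^-1)).
  by rewrite !gmulfM gmulfV gmulfM.
transitivity (quot_proj graph_product_rels 1); last exact: gmulf1.
apply/esym/quot_projP.
by rewrite invg1 mul1g; apply: ncl_gen; exists i, j, g, h.
Qed.

(* The homomorphism to [G k] which is the identity on the factor [G k] and
   trivial on the other ones. *)
Definition factor_proj (k : 'I_m) (a : factors) : G k :=
  @untag 'I_m (fun i => G i) (G k) 1 k id a.
Definition fg_proj (k : 'I_m) : free_group factors -> G k :=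
  fg_lift (factor_proj k).
Definition fp_proj (k : 'I_m) : free_product -> G k := quot_lift (@fg_proj k).
Definition gp_proj (k : 'I_m) : graph_product -> G k := quot_lift (@fp_proj k).

Definition gp_to_prod (x : graph_product) : {dffun forall k, G k} :=
  [ffun k => gp_proj k x].
Definition Cart : set graph_product :=
  [set x | gp_to_prod x = [ffun k => 1]].

Lemma factor_proj_id k (g : G k) : factor_proj k (factor g) = g.
Proof. by rewrite /factor_proj untagE //= => e; rewrite /etagged eq_axiomK. Qed.

Lemma factor_proj_neq k i (g : G i) : i != k -> factor_proj k (factor g) = 1.
Proof. by move=> ik; rewrite /factor_proj untag_dflt. Qed.

Lemma factor_projM k i (g h : G i) :
  factor_proj k (factor (g * h)) =
  factor_proj k (factor g) * factor_proj k (factor h).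
Proof.
have [ik|ik] := eqVneq i k; first by subst k; rewrite !factor_proj_id.
by rewrite !factor_proj_neq // mulg1.
Qed.

Fact fg_proj_rels k r : free_product_rels r -> fg_proj k r = 1.
Proof.
move=> [i [g [h ->]]].
by rewrite /fg_proj !gmulfM gmulfV /= !fg_lift_gen factor_projM mulgV.
Qed.

Lemma fp_projE k x : fp_proj k (quot_proj free_product_rels x) = fg_proj k x.
Proof. exact: (quot_lift_proj _ (@fg_proj_rels k)). Qed.

Lemma fp_proj_in k i (g : G i) : fp_proj k (fp_in g) = factor_proj k (factor g).
Proof. by rewrite fp_projE [LHS]fg_lift_gen. Qed.

Fact fp_proj_morph1 k : fp_proj k 1 = 1.
Proof. by rewrite [LHS]fp_projE [LHS]fg_lift_morph1. Qed.
Fact fp_proj_morphM k : {morph fp_proj k : x y / x * y}.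
Proof. exact: (quot_lift_morphM (@fg_proj_rels k)). Qed.
HB.instance Definition _ k := isUMagmaMorphism.Build free_product (G k)
  (fp_proj k) (conj (fp_proj_morph1 k) (@fp_proj_morphM k)).

Fact fp_proj_rels k r : graph_product_rels r -> fp_proj k r = 1.
Proof.
move=> [i [j [g [h [/andP[ij _] ->]]]]].
rewrite !gmulfM gmulfV gmulfM /= !fp_proj_in.
have [jk|jk] := eqVneq j k; last first.
  by rewrite (factor_proj_neq h jk) mulg1 mul1g mulgV.
by rewrite (@factor_proj_neq k i) -?jk // mulg1 mul1g mulgV.
Qed.

Lemma gp_projE k x : gp_proj k (quot_proj graph_product_rels x) = fp_proj k x.
Proof. exact: (quot_lift_proj _ (@fp_proj_rels k)). Qed.

Lemma gp_proj_id k (g : G k) : gp_proj k (gp_in g) = g.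
Proof. by rewrite gp_projE fp_proj_in factor_proj_id. Qed.

Lemma gp_proj_neq k i (g : G i) : i != k -> gp_proj k (gp_in g) = 1.
Proof. by move=> ik; rewrite gp_projE fp_proj_in factor_proj_neq. Qed.

Fact gp_proj_morph1 k : gp_proj k 1 = 1.
Proof. by rewrite [LHS]gp_projE gmulf1. Qed.
Fact gp_proj_morphM k : {morph gp_proj k : x y / x * y}.
Proof. exact: (quot_lift_morphM (@fp_proj_rels k)). Qed.
HB.instance Definition _ k := isUMagmaMorphism.Build graph_product (G k)
  (gp_proj k) (conj (gp_proj_morph1 k) (@gp_proj_morphM k)).

End GraphProduct.

Arguments Cart {m} G K.

Section Paths.
Local Open Scope ring_scope.
Variables (R : realType) (T : topologicalType).
Implicit Types (X : set T) (f g : R -> T) (x y : T).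

Local Notation I := (`[0, 1]%classic : set R).

(* Only the values on [0, 1] of a path [R -> T] are relevant. *)
Definition is_path X f x y : Prop :=
  [/\ {within I, continuous f}, f @` I `<=` X, f 0 = x & f 1 = y].

Definition same_component X x y : Prop := exists f, is_path X f x y.

Definition path_homotopic X f g : Prop :=
  exists H : R * R -> T,
    [/\ {within I `*` I, continuous H}, H @` (I `*` I) `<=` X,
        forall t, I t -> H (t, 0) = f t /\ H (t, 1) = g t &
        forall s, I s -> H (0, s) = f 0 /\ H (1, s) = f 1].

Definition path_inv f : R -> T := fun t => f (1 - t).
Definition path_cat f g : R -> T :=
  fun t => if t <= 2^-1 then f (2 * t) else g (2 * t - 1).

(* The loops at [x] whose class is in the subgroup of the fundamental group of
   [X] at [x] generated by the classes of the elements of [S]. *)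
Inductive generated_loops X x (S : set (R -> T)) : set (R -> T) :=
| gl_gen f of S f : generated_loops X x S f
| gl_cst : generated_loops X x S (cst x)
| gl_inv f of generated_loops X x S f : generated_loops X x S (path_inv f)
| gl_cat f g of generated_loops X x S f & generated_loops X x S g :
    generated_loops X x S (path_cat f g)
| gl_hom f g of generated_loops X x S f & path_homotopic X f g :
    generated_loops X x S g.

Definition chain0 X : set (T -> rat) :=
  [set c | finite_set [set x | c x != 0] /\ [set x | c x != 0] `<=` X].

Definition reduced_cycle0 X : set (T -> rat) :=
  [set c | chain0 X c /\ \sum_(x \in [set: T]) c x = 0].

Definition point_chain x : T -> rat := fun y => (y == x)%:R.

Definition boundary0 X : set (T -> rat) :=
  [set c | exists n (a : 'I_n -> rat) (f : 'I_n -> R -> T),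
     (forall i, is_path X (f i) (f i 0) (f i 1)) /\
     c = fun y => \sum_(i < n)
           a i * (point_chain (f i 1) y - point_chain (f i 0) y)].

(* The quotient of [reduced_cycle0 X] by [boundary0 X] has dimension [n]. *)
Definition reduced_H0_dim X (n : nat) : Prop :=
  exists z : 'I_n -> T -> rat,
    (forall i, reduced_cycle0 X (z i)) /\
    forall c, reduced_cycle0 X c ->
      exists! a : 'I_n -> rat,
        boundary0 X (fun y => c y - \sum_(i < n) a i * z i y).

(* At most one [n] qualifies; the value is 0 by convention when the dimension is
   infinite. *)
Definition reduced_b0 X : nat := xget 0%N (reduced_H0_dim X).

End Paths.

Arguments same_component R {T} X x y.
Arguments reduced_b0 R {T} X.

Section Realization.
Local Open Scope ring_scope.
Variables (R : realType) (m : nat).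
Implicit Types (K : {set {set 'I_m}}) (i j : 'I_m) (p : seq 'I_m).

Definition realization K : set 'rV[R]_m :=
  [set x | [/\ forall i, 0 <= x 0 i, \sum_i x 0 i = 1 &
               [set i | x 0 i != 0]%SET \in K]].

Definition vertex i : 'rV[R]_m := delta_mx 0 i.

Definition segment (x y : 'rV[R]_m) : R -> 'rV[R]_m :=
  fun t => (1 - t) *: x + t *: y.

(* The path in the realization along the vertices of [i :: p]. *)
Fixpoint edge_path i p : R -> 'rV[R]_m :=
  if p is j :: p' then path_cat (segment (vertex i) (vertex j)) (edge_path j p')
  else cst (vertex i).

Definition component_representatives K (B : set 'I_m) : Prop :=
  forall x, realization K x ->
    exists! i, B i /\ same_component R (realization K) x (vertex i).

End Realization.

Arguments realization R {m} K.
Arguments vertex R {m} i.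
Arguments edge_path R {m} i p.
Arguments component_representatives R {m} K B.

(* The sequence [:: i_1; ...; i_k; i_(k+1)]; a single vertex is the case
   [k = 0]. *)
Definition is_cycle (m : nat) (K : {set {set 'I_m}}) (s : seq 'I_m) : bool :=
  if s is i :: p then
    [&& [set i]%SET \in K, path (edge K) i p & last i p == i]
  else false.

(* Existence of [B]: a base vertex is fixed in each path component. *)
Definition generates_Pi1 (R : realType) (m : nat) (K : {set {set 'I_m}})
    (C : set (seq 'I_m)) : Prop :=
  exists B : set 'I_m,
    [/\ component_representatives R K B,
        forall i p, C (i :: p) -> B i &
        forall b (f : R -> 'rV[R]_m), B b ->
          is_path (realization R K) f (vertex R b) (vertex R b) ->
          generated_loops (realization R K) (vertex R b)
            [set edge_path R b p | p in [set p | C (b :: p)]] f].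

Section Presentation.
Local Open Scope group_scope.
Variables (m : nat) (G : 'I_m -> groupType) (K : {set {set 'I_m}}).
Implicit Types (i : 'I_m) (J : {set 'I_m}) (g : {dffun forall j, G j}).

(* A family indexed by [J] of nontrivial elements is extended by 1 outside
   [J]. *)
Definition supported_on J g : bool := [forall j, (g j != 1) == (j \in J)].
Definition gfamily J := {g : {dffun forall j, G j} | supported_on J g}.

Definition restrict_family J g : {dffun forall j, G j} :=
  [ffun j => if j \in J then g j else 1].

(* [enum J] is in ascending order. *)
Definition L_elt i J g : graph_product G K :=
  (\prod_(j <- enum J) gp_in K (g j)) * (gp_in K (g i))^-1 *
  (\prod_(j <- enum (J :\ i)%SET) gp_in K (g j))^-1.

Definition raw_letter := ('I_m * {set 'I_m} * {dffun forall j, G j})%type.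
Definition letter :=
  {l : raw_letter | (l.1.1 \in l.1.2) && supported_on l.1.2 l.2}.

Variable Theta : {set 'I_m} -> {set 'I_m}.
Definition reduced_letter :=
  {l : raw_letter | (l.1.1 \in Theta l.1.2) && supported_on l.1.2 l.2}.

Definition reduced_letter_elt (l : reduced_letter) : graph_product G K :=
  let: (i, J, g) := val l in L_elt i J g.

(* The family [g] is first restricted to [J]. The default value 1 is never
   used below. *)
Definition L i J g : free_group letter :=
  if insub (i, J, restrict_family J g) is Some l then fg_gen l else 1.
Definition Lhat i J g : free_group reduced_letter :=
  if insub (i, J, restrict_family J g) is Some l then fg_gen l else 1.

(* The path chosen for [i] in [K_J] is [i :: route i J]. *)
Variable route : 'I_m -> {set 'I_m} -> seq 'I_m.

(* Recursion on [n = #|J|]; see [Red_L] for the resulting equation. The list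
   [zip (i :: p) p] consists of the pairs [(i_t, i_(t+1))] in increasing order
   of [t]. *)
Fixpoint Red_rec (n : nat) i J g : free_group reduced_letter :=
  if n is n'.+1 then
    let p := route i J in
    (if last i p \in Theta J then Lhat (last i p) J g else 1) *
    \prod_(e <- rev (zip (i :: p) p))
       (Red_rec n' e.1 (J :\ e.2)%SET g * (Red_rec n' e.2 (J :\ e.1)%SET g)^-1)
  else 1.

Definition Red_letter (l : letter) : free_group reduced_letter :=
  let: (i, J, g) := val l in Red_rec #|J| i J g.

Definition Red : free_group letter -> free_group reduced_letter :=
  fg_lift Red_letter.

Lemma restrict_family_id J g : supported_on J g -> restrict_family J g = g.
Proof.
move=> /forallP gJ; apply/ffunP => j; rewrite ffunE; have := gJ j.
by case: (j \in J) => // /eqP/negbFE/eqP ->.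
Qed.

Lemma restrict_familyS J J' g : J' \subset J ->
  restrict_family J' (restrict_family J g) = restrict_family J' g.
Proof.
move=> /fintype.subsetP sJ; apply/ffunP => j; rewrite !ffunE.
by case: ifP => // /sJ ->.
Qed.

Lemma supported_on_restrict J J' g : supported_on J g -> J' \subset J ->
  supported_on J' (restrict_family J' g).
Proof.
move=> /forallP gJ /fintype.subsetP sJ; apply/forallP => j; rewrite ffunE.
case: ifP => [/sJ jJ|]; last by rewrite eqxx.
by have := gJ j; rewrite jJ.
Qed.

Lemma Red_rec_restrict n i J J' g : J \subset J' ->
  Red_rec n i J (restrict_family J' g) = Red_rec n i J g.
Proof.
elim: n i J => //= n IH i J sJ; congr (_ * _).
  by rewrite /Lhat restrict_familyS.
apply: eq_bigr => e _.
by rewrite !IH // (fintype.subset_trans (subsetDl _ _)).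
Qed.

Lemma Red_LE i J J' g : i \in J -> J \subset J' -> supported_on J' g ->
  Red (L i J g) = Red_rec #|J| i J g.
Proof.
move=> iJ sJ gJ'; rewrite /L insubT /=.
  by rewrite iJ (supported_on_restrict gJ' sJ).
by move=> p; rewrite [LHS]fg_lift_gen /Red_letter /= Red_rec_restrict.
Qed.

Lemma Red_L i J g (p := route i J) : i \in J -> supported_on J g ->
  path (edge (restriction K J)) i p ->
  Red (L i J g) =
    (if last i p \in Theta J then Lhat (last i p) J g else 1) *
    \prod_(e <- rev (zip (i :: p) p))
       (Red (L e.1 (J :\ e.2)%SET g) * (Red (L e.2 (J :\ e.1)%SET g))^-1).
Proof.
move=> iJ gJ pP; rewrite (Red_LE iJ (subxx _) gJ) (cardsD1 i) iJ /= -/p.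
congr (_ * _); rewrite big_seq [RHS]big_seq; apply: eq_bigr => e.
rewrite mem_rev => eP.
have edgeP q k : path (edge (restriction K J)) k q ->
    e \in zip (k :: q) q -> edge (restriction K J) e.1 e.2.
  elim: q k => [|j q IH] k //= /andP[kj qP].
  by rewrite inE => /orP[/eqP -> //|]; exact: IH.
have {edgeP pP eP} /andP[ne] := edgeP _ _ pP eP.
rewrite inE => /andP[_ /fintype.subsetP eJ].
have e1J : e.1 \in J by apply: eJ; rewrite !inE eqxx.
have e2J : e.2 \in J by apply: eJ; rewrite !inE eqxx orbT.
have card_eJ k : k \in J -> #|(J :\ i)%SET| = #|(J :\ k)%SET|.
  by move=> kJ; have := cardsD1 i J; rewrite (cardsD1 k J) iJ kJ => -[].
rewrite (Red_LE _ (subsetDl _ _) gJ) ?inE ?ne // (Red_LE _ (subsetDl _ _) gJ).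
  by rewrite -(card_eJ _ e1J) -(card_eJ _ e2J).
by rewrite !inE eq_sym ne.
Qed.

Definition cycle_relation (s : seq 'I_m) J g : free_group letter :=
  \prod_(e <- zip s (behead s))
     (L e.2 (J :\ e.1)%SET g * (L e.1 (J :\ e.2)%SET g)^-1).

(* The relations form a family indexed by the triples [(J, s, g)] with [s] in
   [Gen J], so that their number is the sum of the [|Gen J| * n_J]. *)
Definition relation_index (Gen : {set 'I_m} -> set (seq 'I_m)) :=
  {J : {set 'I_m} & (Gen J * gfamily J)%type}.

Definition reduced_relation (Gen : {set 'I_m} -> set (seq 'I_m))
    (r : relation_index Gen) : free_group reduced_letter :=
  let: existT J (s, g) := r in Red (cycle_relation (val s) J (val g)).

End Presentation.

Arguments reduced_letter_elt {m G} K {Theta} l.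
Arguments reduced_relation {m G Theta} route Gen r.

Definition is_max (m : nat) (J : {set 'I_m}) (i : 'I_m) : bool :=
  (i \in J) && [forall j in J, (j <= i)%N].

Definition valid_Theta (R : realType) (m : nat) (K : {set {set 'I_m}})
    (J Theta : {set 'I_m}) : Prop :=
  (forall i, i \in Theta -> i \in J /\ ~~ is_max J i) /\
  component_representatives R (restriction K J)
    [set i | (i \in Theta) || is_max J i].

Definition valid_route (m : nat) (K : {set {set 'I_m}}) (J Theta : {set 'I_m})
    (i : 'I_m) (p : seq 'I_m) : Prop :=
  let i' := last i p in
  [/\ path (edge (restriction K J)) i p, (i' \in Theta) || is_max J i' &
      i = i' -> p = [::]].

(* Main.v *)
Require Import Defs.
From HB Require Import structures.
From mathcomp Require Import all_boot all_order all_algebra.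
From mathcomp Require Import all_classical reals topology normedtype.
From mathcomp Require Import lra.

Set Implicit Arguments.
Unset Strict Implicit.
Unset Printing Implicit Defensive.

Import Order.TTheory GRing.Theory Num.Theory.
Import numFieldNormedType.Exports.

Local Open Scope classical_set_scope.
Local Open Scope card_scope.

(* Let P be the group presented by the reduced letters and the reduced
   relations, and let lam_i(t) in P be the class of Red(L_g(i, J)), where t is
   the family g extended by 1 and J is its support. If lam_i(t) = 1 whenever
   t_j = 1 for all j > i, and
     lam_i(t) lam_j(t - i) = lam_j(t) lam_i(t - j)   for all edges {i, j},
   where t - i is t with its i-th entry replaced by 1, then G^K acts on the
   right of P * prod_i G_i (as in the Reidemeister-Schreier method for the
   transversal of the ordered products). The action commutes with left
   multiplication by P, and the orbit of (1, 1) yields an inverse of the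
   evaluation map P -> Cart(G, K).

   The displayed relation is proved by induction on J: the elements
     e(i, j) = lam_i(t - j) lam_j(t - i)^-1   of P
   form a cocycle on the 2-skeleton of K_J by the induction hypothesis, so they
   define a covering of |K_J|, and the reduced relations say that the cycles in
   Gen(J) have trivial holonomy. Lifting homotopies to the covering shows that
   every loop in |K_J| has trivial holonomy, in particular the loop that runs
   from i to the representative of its component along the chosen path, then to
   j along the inverse of the chosen path, and back to i. *)

(** * Graph products *)

Section SymmetricGroup.
Variable X : Type.

Record bijection := Bijection {
  bij_fun : X -> X; bij_inv : X -> X;
  bij_funK : cancel bij_fun bij_inv; bij_invK : cancel bij_inv bij_fun }.

HB.instance Definition _ := gen_eqMixin bijection.
HB.instance Definition _ := gen_choiceMixin bijection.

Lemma bijection_ext (a b : bijection) : bij_fun a =1 bij_fun b -> a = b.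
Proof.
case: a b => [f f' fK f'K] [g g' gK g'K] /= /funext efg; subst g.
have e : f' = g' by apply/funext => x; apply: (can_inj fK); rewrite f'K g'K.
by subst g'; congr Bijection; exact: Prop_irrelevance.
Qed.

(* Composition in diagrammatic order, so that groups act on the right. *)
Definition bij_mul a b :=
  Bijection (can_comp (bij_funK b) (bij_funK a))
            (can_comp (bij_invK a) (bij_invK b)).
Definition bij_one := @Bijection id id (fun=> erefl) (fun=> erefl).
Definition bij_rev a := Bijection (bij_invK a) (bij_funK a).

Fact bij_mulA : associative bij_mul.
Proof. by move=> a b c; exact: bijection_ext. Qed.
Fact bij_mul1 : left_id bij_one bij_mul.
Proof. by move=> a; exact: bijection_ext. Qed.
Fact bij_1mul : right_id bij_one bij_mul.
Proof. by move=> a; exact: bijection_ext. Qed.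
Fact bij_mulV : left_inverse bij_one bij_rev bij_mul.
Proof. by move=> a; apply: bijection_ext => x /=; rewrite bij_invK. Qed.
Fact bij_Vmul : right_inverse bij_one bij_rev bij_mul.
Proof. by move=> a; apply: bijection_ext => x /=; rewrite bij_funK. Qed.

HB.instance Definition _ := isGroup.Build bijection
  bij_mulA bij_mul1 bij_1mul bij_mulV bij_Vmul.

End SymmetricGroup.

Local Open Scope group_scope.

Lemma fg_classM (X : choiceType) (u v : fg_word X) :
  fg_class (u ++ v) = fg_class u * fg_class v.
Proof. exact/esym/fg_mulE. Qed.

Lemma fg_class0 (X : choiceType) : @fg_class X [::] = 1.
Proof. by []. Qed.

Lemma quot_proj_eq1 (H : groupType) (R : set H) x :
  quot_proj R x = 1 <-> normal_closure R x.
Proof.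
have e : quot_proj R 1 = 1 by exact: gmulf1.
rewrite -e; split=> [/esym/quot_projP|xR]; first by rewrite invg1 mul1g.
by apply/esym/quot_projP; rewrite invg1 mul1g.
Qed.

Lemma quot_universal (H H' : groupType) (R : set H)
    (f : UMagmaMorphism.type H H') :
  (forall r, R r -> f r = 1) ->
  exists F : UMagmaMorphism.type (quot_group R) H',
    forall x, F (quot_proj R x) = f x.
Proof.
move=> fR; have FM := quot_lift_morphM fR.
pose F : quot_group R -> H' := quot_lift f.
have F1 : F 1 = 1 by apply: (@mulgI _ (F 1)); rewrite -FM !mulg1.
have FE x : F (quot_proj R x) = f x by exact: quot_lift_proj.
by exists (HB.pack_for (UMagmaMorphism.type (quot_group R) H') F
  (isUMagmaMorphism.Build _ _ F (conj F1 FM))).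
Qed.

(** * Generation and universal property of graph products; ordered products *)

Section GraphProductTheory.
Variables (m : nat) (G : 'I_m -> groupType) (K : {set {set 'I_m}}).

Lemma gp_in1 i : gp_in K (1 : G i) = 1.
Proof. by apply: (@mulgI _ (gp_in K (1 : G i))); rewrite -gp_inM !mulg1. Qed.

Lemma gp_inV i (g : G i) : gp_in K g^-1 = (gp_in K g)^-1.
Proof. by apply/esym/mulg1_eq; rewrite -gp_inM mulgV gp_in1. Qed.

(** Inverse letters are absorbed, because the inverse of [gp_in K g] is [gp_in K g^-1]; so right
    multiplications by elements of the factors reach everything from 1. *)
Lemma gp_ind (Q : graph_product G K -> Prop) :
  Q 1 -> (forall i (g : G i) w, Q w -> Q (w * gp_in K g)) ->
  forall w, Q w.
Proof.
move=> Q1 QM w; rewrite -[w]quot_projK -[repr w]quot_projK.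
rewrite -[repr (repr w)]fg_classK.
elim/last_ind: (repr _) => [//|u [[i g] b] IH].
rewrite -cats1 fg_classM !gmulfM /=.
suff [h ->] : exists h : G i,
    quot_proj (@graph_product_rels _ G K) (quot_proj (@free_product_rels _ G)
      (@fg_class (factors G) [:: (Defs.factor g, b)])) = gp_in K h.
  exact: QM.
case: b; first by exists g.
exists g^-1; rewrite gp_inV.
rewrite fg_class_cons fg_class0 mulg1 /=.
by rewrite gmulfV gmulfV.
Qed.

(** The map descends in two stages: multiplicativity of the [h i] kills the relations of the free
    product, then commutation along edges kills those of the graph product. *)
Lemma gp_universal (H : groupType) (h : forall i, G i -> H) :
  (forall i, {morph h i : x y / x * y}) ->
  (forall i j (x : G i) (y : G j), edge K i j -> h i x * h j y = h j y * h i x) ->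
  exists F : UMagmaMorphism.type (graph_product G K) H,
    forall i (x : G i), F (gp_in K x) = h i x.
Proof.
move=> hM hC.
have [|F1 F1E] := @quot_universal _ _ (@free_product_rels _ G)
    (fg_lift (fun a : factors G => h (tag a) (tagged a))).
  move=> r [i [x [y ->]]]; rewrite !gmulfM gmulfV /= !fg_lift_gen /=.
  by rewrite hM mulgV.
have {}F1E i (x : G i) : F1 (fp_in x) = h i x by rewrite F1E /= fg_lift_gen.
have [|F2 F2E] := @quot_universal _ _ (@graph_product_rels _ G K) F1.
  move=> r [i [j [x [y [ij ->]]]]]; rewrite !gmulfM gmulfV gmulfM !F1E.
  by rewrite (hC _ _ _ _ ij) mulgV.
by exists F2 => i x; rewrite F2E F1E.
Qed.

Local Notation family := {dffun forall j, G j}.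
Implicit Types (t : family) (i j : 'I_m).

Definition fam1 : family := [ffun=> 1].
(** Only entry [i] changes, as [factor_proj] is trivial at the other indices; using it avoids a cast
    of [x] along an equality [k = i]. *)
Definition fam_mul t i (x : G i) : family :=
  [ffun k => t k * factor_proj k (Defs.factor x)].
Definition fam_drop t i : family := [ffun k => if k == i then 1 else t k].

Lemma fam_mulE t i (x : G i) : fam_mul t x i = t i * x.
Proof. by rewrite ffunE factor_proj_id. Qed.
Lemma fam_mul_neq t i (x : G i) k : k != i -> fam_mul t x k = t k.
Proof. by move=> ki; rewrite ffunE factor_proj_neq ?mulg1 // eq_sym. Qed.

Lemma fam_mulM t i (x y : G i) : fam_mul t (x * y) = fam_mul (fam_mul t x) y.
Proof. by apply/ffunP => k; rewrite !ffunE factor_projM mulgA. Qed.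

Lemma fam_mul1 t i : fam_mul t (1 : G i) = t.
Proof.
apply/ffunP => k; have [->|ki] := eqVneq k i; first by rewrite fam_mulE mulg1.
by rewrite fam_mul_neq.
Qed.

Lemma fam_mulC t i j (x : G i) (y : G j) : i != j ->
  fam_mul (fam_mul t x) y = fam_mul (fam_mul t y) x.
Proof.
move=> ij; apply/ffunP => k.
have [->|ki] := eqVneq k i; first by rewrite fam_mul_neq // !fam_mulE fam_mul_neq.
have [->|kj] := eqVneq k j; last by rewrite !fam_mul_neq.
by rewrite eq_sym in ij; rewrite fam_mulE 2?fam_mul_neq ?fam_mulE.
Qed.

Lemma fam_mulV t i : fam_mul t (t i)^-1 = fam_drop t i.
Proof.
apply/ffunP => k; rewrite [RHS]ffunE; case: eqVneq => [->|ki].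
  by rewrite fam_mulE mulgV.
by rewrite fam_mul_neq.
Qed.

Lemma fam_drop_mul t i (x : G i) : fam_drop (fam_mul t x) i = fam_drop t i.
Proof.
apply/ffunP => k; rewrite !ffunE; case: eqVneq => // ki.
by rewrite factor_proj_neq ?mulg1 // eq_sym.
Qed.

Lemma fam_dropC t i j : fam_drop (fam_drop t i) j = fam_drop (fam_drop t j) i.
Proof. by apply/ffunP => k; rewrite !ffunE; do 2?case: ifP. Qed.

(** These ordered products form a transversal of [Cart G K] in the graph product. *)
Definition fam_prod t : graph_product G K :=
  \prod_(j <- enum 'I_m) gp_in K (t j).

Lemma fam_prod1 : fam_prod fam1 = 1.
Proof. by rewrite /fam_prod big1 // => j _; rewrite ffunE gp_in1. Qed.

(* The element [L_g(i, J)] where [J] is the support of [t]. *)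
Definition fam_L i t : graph_product G K :=
  fam_prod t * (gp_in K (t i))^-1 * (fam_prod (fam_drop t i))^-1.

(** Both sides telescope to [fam_prod t], times the inverses of the two commuting entries, times the
    inverse of the ordered product of [t] without [i] and [j]. *)
Lemma fam_L_edge i j t : edge K i j ->
  fam_L i t * fam_L j (fam_drop t i) = fam_L j t * fam_L i (fam_drop t j).
Proof.
move=> ij; have /negbTE ne : i != j by case/andP: ij.
rewrite /fam_L -!mulgA !mulKg !ffunE ne eq_sym ne; congr (_ * _).
rewrite fam_dropC (mulgA (gp_in K (t i))^-1) (mulgA (gp_in K (t j))^-1) -!invgM.
by rewrite (gp_in_comm _ _ ij).
Qed.

Lemma gp_proj_fam_prod k t : gp_proj k (fam_prod t) = t k.
Proof.
rewrite /fam_prod gmulf_prod.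
have e (j : 'I_m) : gp_proj k (gp_in K (t j)) = if j == k then t k else 1.
  have [->|jk] := eqVneq j k; first by rewrite gp_proj_id.
  by rewrite gp_proj_neq.
rewrite (eq_bigr _ (fun j _ => e j)) {e} -big_mkcond /=.
rewrite -big_filter filter_pred1_uniq ?mem_enum ?enum_uniq //.
by rewrite big_seq1.
Qed.

Lemma Cart_proj w : Cart G K w <-> forall k, gp_proj k w = 1.
Proof.
rewrite /Cart /=; split=> [/ffunP e k|e]; first by have := e k; rewrite !ffunE.
by apply/ffunP => k; rewrite !ffunE.
Qed.

Lemma fam_L_Cart i t : Cart G K (fam_L i t).
Proof.
apply/Cart_proj => k; rewrite /fam_L !gmulfM !gmulfV /= !gp_proj_fam_prod ffunE.
have [->|ki] := eqVneq k i; first by rewrite gp_proj_id invg1 mulg1 mulgV.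
by rewrite gp_proj_neq 1?eq_sym // invg1 mulg1 mulgV.
Qed.

(** The entry [t i] stands at the right end of the ordered product, so cancelling it on the right
    leaves exactly the ordered product of [fam_drop t i]. *)
Lemma fam_L_last i t : (forall j, (i < j)%N -> t j = 1) -> fam_L i t = 1.
Proof.
move=> ti.
suff e : fam_prod t = fam_prod (fam_drop t i) * gp_in K (t i).
  by rewrite /fam_L e mulgK mulgV.
have := enum_uniq 'I_m; have : sorted ltn [seq val j | j <- enum 'I_m].
  by rewrite val_enum_ord iota_ltn_sorted.
rewrite /fam_prod; have /splitPr[s1 s2] : i \in enum 'I_m by rewrite mem_enum.
rewrite map_cat /= cat_uniq => /cat_sorted2[_ /=].
rewrite (path_sortedE ltn_trans) => /andP[/allP s2P _].
move=> /and3P[_ /norP[/negP s1i _] _].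
have s2i j : j \in s2 -> (i < j)%N by move=> js; apply/s2P/map_f.
rewrite !big_cat !big_cons /= ffunE eqxx gp_in1 mul1g.
rewrite !(big1_seq s2) ?mulg1 => [|j /andP[_ /s2i ij]|j /andP[_ /s2i ij]].
- congr (_ * _); apply: eq_big_seq => j js1; rewrite ffunE; case: eqVneq => // e.
  by case: s1i; rewrite -e.
- by rewrite ffunE ti // if_same gp_in1.
- by rewrite ti // gp_in1.
Qed.

Definition fam_supp t : {set 'I_m} := [set j | t j != 1].

Lemma fam_suppP t : supported_on (fam_supp t) t.
Proof. by apply/forallP => j; rewrite inE. Qed.

Lemma supported_fam_supp (J : {set 'I_m}) t : supported_on J t -> fam_supp t = J.
Proof. by move=> /forallP tJ; apply/setP => j; rewrite inE (eqP (tJ j)). Qed.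

Lemma fam_supp_drop t i : fam_supp (fam_drop t i) = (fam_supp t :\ i)%SET.
Proof.
by apply/setP => j; rewrite !inE ffunE; have [_|] := eqVneq j i; rewrite ?eqxx.
Qed.

Lemma prod_enum_set (J : {set 'I_m}) t :
  \prod_(j <- enum J) gp_in K (t j) = fam_prod (restrict_family J t).
Proof.
rewrite /fam_prod [enum J]/enum_mem -enumT big_filter big_mkcond.
by apply: eq_bigr => j _; rewrite ffunE; case: ifP => jJ; rewrite [j \in J]jJ ?gp_in1.
Qed.

Lemma L_eltE i (J : {set 'I_m}) t : supported_on J t -> L_elt K i J t = fam_L i t.
Proof.
move=> tJ; rewrite /L_elt /fam_L !prod_enum_set restrict_family_id //.
congr (_ * (fam_prod _)^-1); apply/ffunP => j; rewrite !ffunE !inE.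
case: eqVneq => //= _; have /forallP/(_ j)/eqP <- := tJ.
by case: eqVneq => [->|].
Qed.

(** * The right action of the graph product on pairs of an element of [P] and a family *)

Section Action.
Variables (P : groupType) (lam : 'I_m -> family -> P).
Hypothesis lam_last : forall i t, (forall j, (i < j)%N -> t j = 1) -> lam i t = 1.
Hypothesis lam_id : forall i t, t i = 1 -> lam i t = 1.
Hypothesis lam_edge : forall i j t, edge K i j ->
  lam i t * lam j (fam_drop t i) = lam j t * lam i (fam_drop t j).

(* The action of [x] in [G_i] on [P * prod_i G_i]. *)
Definition lam_step i (x : G i) (pt : P * family) : P * family :=
  (pt.1 * lam i pt.2 * (lam i (fam_mul pt.2 x))^-1, fam_mul pt.2 x).

Lemma lam_stepM i (x y : G i) pt : lam_step (x * y) pt = lam_step y (lam_step x pt).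
Proof. by rewrite /lam_step /= fam_mulM -!mulgA mulKg. Qed.

Lemma lam_step1 i pt : lam_step (1 : G i) pt = pt.
Proof. by case: pt => p t; rewrite /lam_step fam_mul1 mulgK. Qed.

Lemma lam_stepK i (x : G i) : cancel (lam_step x) (lam_step x^-1).
Proof. by move=> pt; rewrite -lam_stepM mulgV lam_step1. Qed.
Lemma lam_stepVK i (x : G i) : cancel (lam_step x^-1) (lam_step x).
Proof. by move=> pt; rewrite -lam_stepM mulVg lam_step1. Qed.

(** By [lam_edge] at the intermediate family, two steps along an edge contribute a quantity at the
    initial family times the inverse of one at the final family. Again by [lam_edge], both are
    symmetric in [i] and [j], whence the two steps commute. *)
Lemma lam_square i j (x : G i) (y : G j) t : edge K i j ->
  lam i t * (lam i (fam_mul t x))^-1 * lam j (fam_mul t x) *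
    (lam j (fam_mul (fam_mul t x) y))^-1 =
  lam i t * lam j (fam_drop t i) *
    (lam j (fam_mul (fam_mul t x) y) *
     lam i (fam_drop (fam_mul (fam_mul t x) y) j))^-1.
Proof.
move=> ij; rewrite invgM fam_drop_mul !mulgA; congr (_ * _).
rewrite -!mulgA; congr (_ * _); apply: (@mulgI _ (lam i (fam_mul t x))).
rewrite mulVKg -(fam_drop_mul t x) !mulgA.
by rewrite lam_edge // mulgK.
Qed.

Lemma lam_stepC i j (x : G i) (y : G j) pt : edge K i j ->
  lam_step y (lam_step x pt) = lam_step x (lam_step y pt).
Proof.
move=> ij; case: pt => p t; have ne : i != j by case/andP: ij.
have ji : edge K j i by move: ij; rewrite /edge eq_sym finset.setUC.
rewrite /lam_step /= (fam_mulC t x y ne); congr (_, _).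
rewrite -!(mulgA p); congr (p * _).
rewrite -{1}(fam_mulC t x y ne) !lam_square // (fam_mulC t x y ne).
by rewrite (lam_edge _ ij) (lam_edge _ ij).
Qed.

Definition lam_bij i (x : G i) := Bijection (@lam_stepK i x) (lam_stepVK x).

Lemma lam_step_drop i t p : lam_step (t i)^-1 (p, t) = (p * lam i t, fam_drop t i).
Proof.
rewrite /lam_step /= fam_mulV (lam_id (t := fam_drop t i)) ?ffunE ?eqxx //.
by rewrite invg1 mulg1.
Qed.

Section Hom.
Variable act : UMagmaMorphism.type (graph_product G K) (bijection (P * family)).
Hypothesis actE : forall i (x : G i), act (gp_in K x) = lam_bij x.

Lemma actM w w' pt :
  bij_fun (act (w * w')) pt = bij_fun (act w') (bij_fun (act w) pt).
Proof. by rewrite gmulfM. Qed.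
Lemma act1 pt : bij_fun (act 1) pt = pt. Proof. by rewrite gmulf1. Qed.

Lemma act_mull w p q t :
  bij_fun (act w) (p * q, t) =
  (p * (bij_fun (act w) (q, t)).1, (bij_fun (act w) (q, t)).2).
Proof.
elim/gp_ind: w p q t => [p q t|i x w IH p q t]; first by rewrite !act1.
by rewrite !actM actE IH /= /lam_step /= !mulgA.
Qed.

Lemma act_proj w p t k : (bij_fun (act w) (p, t)).2 k = t k * gp_proj k w.
Proof.
elim/gp_ind: w p t => [p t|i x w IH p t]; first by rewrite act1 gmulf1 mulg1.
rewrite actM actE /= ffunE IH gmulfM mulgA; congr (_ * _).
by rewrite /= gp_projE fp_proj_in.
Qed.

(** The factors act in ascending order, so the factor at [j] meets a family that is 1 from [j] on.
    One of the two [lam] in its step is then 1 by [lam_id], the other by [lam_last]. *)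
Lemma act_fam_prod t p : bij_fun (act (fam_prod t)) (p, fam1) = (p, t).
Proof.
have lt_enum : pairwise (fun a b : 'I_m => a < b)%N (enum 'I_m).
  have := iota_ltn_sorted 0 m; rewrite -val_enum_ord.
  by rewrite (sorted_pairwise ltn_trans) pairwise_map.
(* Restricting [t] to the indices already multiplied gives a statement that makes sense for every
   prefix of [enum 'I_m]. *)
transitivity (p, restrict_family [set j in enum 'I_m]%SET t); last first.
  by congr (_, _); apply/ffunP => j; rewrite ffunE inE mem_enum.
rewrite /fam_prod; elim/last_ind: (enum 'I_m) lt_enum => [_|s j IH].
  by rewrite big_nil act1; congr (_, _); apply/ffunP => j; rewrite !ffunE inE.
rewrite pairwise_rcons => /andP[/allP/= sj /IH]; rewrite -cats1 big_cat big_seq1.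
rewrite actM actE => -> /=.
set u := restrict_family _ _.
have uj : u j = 1.
  by rewrite ffunE inE; case: ifP => // /sj; rewrite ltnn.
rewrite /lam_step /= (lam_id uj) lam_last ?invg1 ?mulg1 => [|k jk].
  congr (_, _); apply/ffunP => k; have [->|kj] := eqVneq k j.
    by rewrite fam_mulE uj mul1g ffunE inE mem_cat mem_seq1 eqxx orbT.
  by rewrite fam_mul_neq // !ffunE !inE mem_cat mem_seq1 (negbTE kj) orbF.
rewrite fam_mul_neq ?ffunE ?inE; last by rewrite neq_ltn jk orbT.
by case: ifP => // /sj kj; have := ltn_trans jk kj; rewrite ltnn.
Qed.

(** The three factors of [fam_L i t] lead from [fam1] up to [t], then to [fam_drop t i], then back
    to [fam1]; only the middle one changes the first coordinate, by [lam i t]. *)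
Lemma act_fam_L i t w p : bij_fun (act (fam_L i t * w)) (p, fam1) =
  bij_fun (act w) (p * lam i t, fam1).
Proof.
rewrite /fam_L !actM act_fam_prod; congr (bij_fun _ _).
rewrite -gp_inV actE /= lam_step_drop.
apply: (can_inj (bij_funK (act (fam_prod (fam_drop t i))))).
by rewrite -actM mulVg act1 act_fam_prod.
Qed.

Lemma act_psi i t w : (bij_fun (act (fam_L i t * w)) (1, fam1)).1 =
  lam i t * (bij_fun (act w) (1, fam1)).1.
Proof. by rewrite act_fam_L mul1g -(mulg1 (lam i t)) act_mull mulg1. Qed.

Variable fb : UMagmaMorphism.type P (graph_product G K).
Hypothesis fb_lam : forall i t, fb (lam i t) = fam_L i t.

(** The pair [(p, t)] stands for the element [fb p * fam_prod t], on which the action is right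
    multiplication: for [x] in a factor [G i], [fam_prod t] times [x] is [fam_L i t], times the
    inverse of [fam_L i (fam_mul t x)], times [fam_prod (fam_mul t x)]. *)
Lemma act_section w p t : fb (bij_fun (act w) (p, t)).1 *
  fam_prod (bij_fun (act w) (p, t)).2 = fb p * fam_prod t * w.
Proof.
elim/gp_ind: w p t => [p t|i x w IH p t]; first by rewrite act1 mulg1.
rewrite actM actE mulgA -IH /=; case: (bij_fun _ _) => {}p {}t /=.
rewrite !gmulfM gmulfV /= !fb_lam /fam_L fam_drop_mul fam_mulE.
rewrite !invgM !invgK -!mulgA mulKg mulVg mulg1.
by rewrite gp_inM mulKg.
Qed.

Lemma Cart_fb w : Cart G K w -> exists p, w = fb p.
Proof.
move=> /Cart_proj w1; exists (bij_fun (act w) (1, fam1)).1.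
have := act_section w 1 fam1; rewrite gmulf1 mul1g fam_prod1 mul1g => {1}<-.
suff e : (bij_fun (act w) (1, fam1)).2 = fam1 by rewrite e fam_prod1 mulg1.
by apply/ffunP => k; rewrite act_proj w1 mulg1.
Qed.

End Hom.

Lemma act_ex : exists act :
    UMagmaMorphism.type (graph_product G K) (bijection (P * family)),
  forall i (x : G i), act (gp_in K x) = lam_bij x.
Proof.
apply: gp_universal => [i x y|i j x y ij].
  by apply: bijection_ext => pt; exact: lam_stepM.
by apply: bijection_ext => pt; exact: lam_stepC.
Qed.

(** The map [psi] takes the first coordinate in the orbit of [(1, fam1)]. It serves to undo the
    evaluation map, and thus to prove its injectivity. *)
Lemma lam_section : exists psi : graph_product G K -> P, psi 1 = 1 /\
  forall i t w, psi (fam_L i t * w) = lam i t * psi w.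
Proof.
have [act actE] := act_ex; exists (fun w => (bij_fun (act w) (1, fam1)).1).
by split=> [|i t w]; [rewrite gmulf1|exact: act_psi].
Qed.

Lemma Cart_lam (fb : UMagmaMorphism.type P (graph_product G K)) :
  (forall i t, fb (lam i t) = fam_L i t) ->
  forall w, Cart G K w -> exists p, w = fb p.
Proof. by have [act actE] := act_ex; exact: Cart_fb. Qed.

End Action.

End GraphProductTheory.

(** * Coverings of a complex defined by cocycles *)

Section Topology.
Local Open Scope ring_scope.

Lemma connected_clopen (T : topologicalType) (A B : set T) :
  connected A -> B `<=` A -> B !=set0 ->
  (forall y, B y -> \forall z \near within A (nbhs y), B z) ->
  (forall y, A y -> ~ B y -> \forall z \near within A (nbhs y), ~ B z) ->
  B = A.
Proof.
move=> Ac BA B0 Bo Bc; apply: Ac => //.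
(* The nearness assumption says that points of [B] are interior to this set, so its interior meets
   [A] exactly in [B]. *)
- exists (interior [set z | A z -> B z]); first exact: open_interior.
  apply/seteqP; split=> y.
    by move=> By; split; [exact: BA|exact: Bo].
  by move=> [Ay /interior_subset]; apply.
- exists (~` interior [set z | A z -> ~ B z]).
    exact/open_closedC/open_interior.
  apply/seteqP; split=> y.
    by move=> By; split=> [|/interior_subset]; [exact: BA|apply => //; exact: BA].
  move=> [Ay nBy]; apply: contrapT => By; apply: nBy; exact: Bc.
Qed.

(** Compactness of the interval as a supremum argument: the supremum [c] of the points reached from
    0 is itself reached, through the local hypothesis at [c], and if [c < 1] one can go on beyond
    it. *)
Lemma interval_induction (R : realType) (Q : R -> R -> Prop) :
  (forall a b c, a <= b -> b <= c -> Q a b -> Q b c -> Q a c) ->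
  (forall x, 0 <= x <= 1 -> exists2 d, 0 < d & forall a b,
     0 <= a -> a <= x -> x <= b -> b <= 1 -> x - d < a -> b < x + d -> Q a b) ->
  Q 0 1.
Proof.
move=> Qtrans Qloc.
pose S := [set x | 0 <= x <= 1 /\ Q 0 x] : set R.
have S0 : S 0.
  have [|d d0 dP] := Qloc 0; first by rewrite lexx ler01.
  by split; [rewrite lexx ler01|apply: dP => //; lra].
have ubS : ubound S 1 by move=> x [/andP[]].
have supS : has_sup S by split; [exists 0|exists 1].
set c := sup S.
have c01 : 0 <= c <= 1.
  by rewrite ge_sup ?andbT //; [apply: sup_upper_bound|exists 0].
have [d d0 dP] := Qloc _ c01.
have [x [/andP[x0 x1] Qx] cx] := sup_adherent d0 supS.
have xc : x <= c by apply: sup_upper_bound => //; split=> //; rewrite x0.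
have step b : c <= b -> b <= 1 -> b < c + d -> Q 0 b.
  move=> cb b1 bd; apply: (Qtrans _ x) => //; first exact: le_trans cb.
  by apply: dP.
have [c1|c1] := eqVneq c 1; first by apply: step; lra.
have {}c1 : c < 1 by rewrite lt_neqAle c1; case/andP: c01.
pose b := Num.min 1 (c + d / 2).
have cb : c < b by rewrite lt_min c1; lra.
have b1 : b <= 1 by rewrite ge_min lexx.
have : b <= c.
  apply: sup_upper_bound => //; split; first by rewrite b1 andbT; lra.
  by apply: step; [lra|lra|rewrite gt_min; apply/orP; right; lra].
lra.
Qed.

End Topology.

(** * Lifts to the covering: uniqueness, gluing, and existence over a square *)

Section Lifts.
Variables (R : realType) (m : nat) (P : groupType) (e : 'I_m -> 'I_m -> P).

(* The points over [y] of the covering of the complex defined by the cocycle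
   [e] are the maps [x] on the support of [F y] with [x w = e v w * x v]; a
   lift of [F] to this covering is a locally constant choice of such maps. *)
Definition lift_on (Y : topologicalType) (F : Y -> 'rV[R]_m) (A : set Y)
    (s : Y -> 'I_m -> P) : Prop :=
  forall y, A y ->
    (forall v w, F y 0%R v != 0%R -> F y 0%R w != 0%R -> s y w = e v w * s y v) /\
    forall v, F y 0%R v != 0%R ->
      \forall z \near within A (nbhs y), F z 0%R v != 0%R /\ s z v = s y v.

Section General.
Variable Y : topologicalType.
Implicit Types (F : Y -> 'rV[R]_m) (A B : set Y) (s : Y -> 'I_m -> P).

Lemma lift_comp (Y' : topologicalType) (h : Y' -> Y) F A (A' : set Y') s :
  {within A', continuous h} -> h @` A' `<=` A -> lift_on F A s ->
  lift_on (F \o h) A' (s \o h).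
Proof.
move=> /subspace_continuousP hc hA sP y A'y.
have [sE sl] := sP _ (hA _ (imageP h A'y)).
split=> // v Fv; have := sl v Fv; rewrite !near_withinE => nA.
have hy : h @ within A' (nbhs y) --> h y := hc _ A'y.
have : \forall z \near within A' (nbhs y), A (h z) -> F (h z) 0%R v != 0%R /\
    s (h z) v = s (h y) v := hy _ nA.
rewrite near_withinE; apply: filterS => z + A'z => /(_ A'z); apply.
by apply: hA; exists z.
Qed.

Lemma lift_subset F A B s : B `<=` A -> lift_on F A s -> lift_on F B s.
Proof.
move=> BA sP y By; have [sE sl] := sP _ (BA _ By); split=> // v /sl.
rewrite !near_withinE; apply: filterS => z + Bz; by apply; exact: BA.
Qed.

Lemma lift_eq F F' A s s' :
  (forall y, A y -> F y = F' y) -> (forall y, A y -> s y = s' y) ->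
  lift_on F A s -> lift_on F' A s'.
Proof.
move=> FF' ss' sP y Ay; have [sE sl] := sP _ Ay; rewrite -FF' // -ss' //.
split=> // v /sl; rewrite !near_withinE; apply: filterS => z + Az.
by rewrite -FF' // -ss' //; exact.
Qed.

(** Right multiplications are deck transformations, since the cocycle acts from the left. *)
Lemma lift_mulr F A s c : lift_on F A s -> lift_on F A (fun y v => s y v * c).
Proof.
move=> sP y Ay; have [sE sl] := sP _ Ay; split=> [v w Fv Fw|v /sl].
  by rewrite mulgA (sE v).
by apply: filterS => z [? ->].
Qed.

Definition covered F A := forall y, A y -> exists v, F y 0%R v != 0%R.

(** By the cocycle formula, agreement at one vertex of the support gives agreement at all of them.
    Local constancy then makes the set of agreement open and closed in [A]. *)
Lemma lift_unique F A s s' y0 v0 : connected A -> covered F A ->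
  lift_on F A s -> lift_on F A s' -> A y0 -> F y0 0%R v0 != 0%R ->
  s y0 v0 = s' y0 v0 -> forall y v, A y -> F y 0%R v != 0%R -> s y v = s' y v.
Proof.
move=> Ac FA sP s'P Ay0 Fv0 e0.
pose B := [set y | A y /\ forall v, F y 0%R v != 0%R -> s y v = s' y v].
have BE y v : A y -> F y 0%R v != 0%R -> s y v = s' y v -> B y.
  move=> Ay Fv ev; split=> // w Fw.
  by rewrite ((sP _ Ay).1 v w) // ((s'P _ Ay).1 v w) // ev.
suff /seteqP[_ sub] : B = A by move=> y v /sub[_]; exact.
apply: connected_clopen => //.
- by move=> y [].
- by exists y0; exact: BE Fv0 e0.
- move=> y [Ay ey]; have [v Fv] := FA _ Ay.
  have := (sP _ Ay).2 _ Fv; have := (s'P _ Ay).2 _ Fv.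
  rewrite !near_withinE.
  apply: filterS2 => z + + Az => /(_ Az)[_ e2] /(_ Az)[Fz e1].
  by apply: BE (Fz) _ => //; rewrite e1 e2 ey.
- move=> y Ay nBy; have [v Fv] := FA _ Ay.
  have := (sP _ Ay).2 _ Fv; have := (s'P _ Ay).2 _ Fv.
  rewrite !near_withinE.
  apply: filterS2 => z + + Az => /(_ Az)[_ e2] /(_ Az)[Fz e1] [_ ez].
  by apply: nBy; apply: BE (Fv) _ => //; rewrite -e1 -e2 ez.
Qed.

(** Local constancy is checked on [A] and on [B] separately; off a closed piece, its complement is a
    neighbourhood on which there is nothing to check. *)
Lemma lift_glue_eq F A B s s' : closed A -> closed B ->
  lift_on F A s -> lift_on F B s' ->
  (forall y v, A y -> B y -> F y 0%R v != 0%R -> s y v = s' y v) ->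
  lift_on F (A `|` B) (fun y => if y \in A then s y else s' y).
Proof.
move=> Acl Bcl sP s'P ss'; set t := (X in lift_on _ _ X) => y ABy.
have tA z : A z -> t z = s z by move=> Az; rewrite /t mem_set.
have tB z v : B z -> F z 0%R v != 0%R -> t z v = s' z v.
  by move=> Bz Fv; rewrite /t; case: ifPn => // /set_mem Az; exact: ss'.
split=> [v w Fv Fw|v Fv].
  case: ABy => [Ay|By]; first by rewrite tA // ((sP _ Ay).1 v w).
  by rewrite !tB // ((s'P _ By).1 v w).
have nA : \forall z \near y, A z -> F z 0%R v != 0%R /\ t z v = t y v.
  have [Ay|nAy] := pselect (A y).
    have := (sP _ Ay).2 v Fv; rewrite near_withinE; apply: filterS => z zP Az.
    by rewrite !tA //; exact: zP.
  by apply: filterS (open_nbhs_nbhs (conj (closed_openC Acl) nAy)) => z.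
have nB : \forall z \near y, B z -> F z 0%R v != 0%R /\ t z v = t y v.
  have [By|nBy] := pselect (B y).
    have := (s'P _ By).2 v Fv; rewrite near_withinE; apply: filterS => z zP Bz.
    by have [Fz sz] := zP Bz; split=> //; rewrite !tB.
  by apply: filterS (open_nbhs_nbhs (conj (closed_openC Bcl) nBy)) => z.
by rewrite near_withinE; apply: filterS2 nA nB => z zA zB [/zA|/zB].
Qed.

Lemma lift_glue F A B s s' : closed A -> closed B -> connected (A `&` B) ->
  A `&` B !=set0 -> covered F (A `&` B) ->
  lift_on F A s -> lift_on F B s' -> exists s'', lift_on F (A `|` B) s''.
Proof.
move=> Acl Bcl ABc [y [Ay By]] FAB sP s'P; have [v Fv] := FAB y (conj Ay By).
(* This deck transformation makes [s'] agree with [s] at [y], hence by uniqueness on the whole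
   connected intersection. *)
eexists; apply: (lift_glue_eq Acl Bcl sP (lift_mulr ((s' y v)^-1 * s y v) s'P)).
move=> z w Az Bz Fw.
apply: (@lift_unique F (A `&` B) s
  (fun y0 v0 => s' y0 v0 * ((s' y v)^-1 * s y v)) y v) => //.
- by apply: lift_subset sP => ? [].
- by apply: lift_subset (lift_mulr _ s'P) => ? [].
- by rewrite mulVKg.
Qed.

Definition support_open F A := forall y v, A y -> F y 0%R v != 0%R ->
  \forall z \near within A (nbhs y), F z 0%R v != 0%R.

Lemma continuous_support_open F A : {within A, continuous F} -> support_open F A.
Proof.
move=> /subspace_continuousP Fc y v Ay Fv.
have : open_nbhs (F y) [set x : 'rV[R]_m | x 0%R v != 0%R].
  split=> //; apply: (open_comp (D := [set x : R | x != 0%R])) => [x _|].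
    exact: coord_continuous.
  exact: open_neq.
by move=> /open_nbhs_nbhs; exact: Fc.
Qed.

(** Local triviality: over the star of [v] the cocycle condition makes [e v] a constant section. *)
Lemma lift_cst F A v : support_open F A ->
  (forall y w w', A y -> F y 0%R w != 0%R -> F y 0%R w' != 0%R ->
     e v w' = e w w' * e v w) ->
  lift_on F A (fun _ w => e v w).
Proof.
move=> Fo eA y Ay; split=> [w w'|w Fw]; first exact: eA.
by apply: filterS (Fo _ _ Ay Fw) => z.
Qed.

End General.

Section Squares.
Local Open Scope ring_scope.

Definition rect (a b c d : R) : set (R * R) := `[a, b] `*` `[c, d].

Lemma rectP a b c d z :
  rect a b c d z <-> (a <= z.1 <= b) /\ (c <= z.2 <= d).
Proof. by rewrite /rect /setX /= !in_itv. Qed.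

Lemma rect_sub a b c d a' b' c' d' : a <= a' -> b' <= b -> c <= c' -> d' <= d ->
  rect a' b' c' d' `<=` rect a b c d.
Proof.
move=> aa bb cc dd z /rectP[/andP[z1 z2] /andP[z3 z4]]; apply/rectP.
by rewrite (le_trans aa) ?(le_trans _ bb) ?(le_trans cc) ?(le_trans _ dd).
Qed.

Lemma rectU a b c d f : a <= b -> b <= c ->
  rect a c d f = rect a b d f `|` rect b c d f.
Proof.
move=> ab bc; apply/seteqP; split=> z; last first.
  by move=> []; apply: rect_sub.
move=> /rectP[/andP[z1 z2] z3].
by have [zb|/ltW bz] := leP z.1 b; [left|right]; apply/rectP; split=> //; apply/andP.
Qed.

Lemma rectI a b c d f : a <= b -> b <= c ->
  rect a b d f `&` rect b c d f = rect b b d f.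
Proof.
move=> ab bc; apply/seteqP; split=> z.
  move=> [/rectP[/andP[_ z2] z3] /rectP[/andP[z1 _] _]].
  by apply/rectP; rewrite z1 z2.
by move=> zb; split; apply: rect_sub zb.
Qed.

Lemma rectUv a b c d f : d <= f -> c <= d ->
  rect a b c f = rect a b c d `|` rect a b d f.
Proof.
move=> df cd; apply/seteqP; split=> z; last first.
  by move=> []; apply: rect_sub.
move=> /rectP[z3 /andP[z1 z2]].
by have [zb|/ltW bz] := leP z.2 d; [left|right]; apply/rectP; split=> //; apply/andP.
Qed.

Lemma rectIv a b c d f : d <= f -> c <= d ->
  rect a b c d `&` rect a b d f = rect a b d d.
Proof.
move=> df cd; apply/seteqP; split=> z.
  move=> [/rectP[z3 /andP[_ z2]] /rectP[_ /andP[z1 _]]].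
  by apply/rectP; rewrite z1 z2.
by move=> zb; split; apply: rect_sub zb.
Qed.

Lemma rect_closed a b c d : closed (rect a b c d).
Proof.
have -> : rect a b c d = fst @^-1` `[a, b] `&` snd @^-1` `[c, d] by [].
by apply: closedI; apply: closed_comp; [|exact: itv_closed|
  |exact: itv_closed]; move=> z _; [exact: cvg_fst|exact: cvg_snd].
Qed.

Lemma hsegment_connected a b c : connected (rect a b c c).
Proof.
rewrite (_ : rect a b c c = (fun t => (t, c)) @` `[a, b]).
  apply: connected_continuous_connected; first exact: segment_connected.
  apply: continuous_subspaceT => t; exact: cvg_pair cvg_id (cvg_cst _).
apply/seteqP; split=> [[t s] /rectP/= [tab sc]|[t s] [u /= uab [<- <-]]].
  exists t; first by rewrite /= in_itv.
  by congr (_, _); apply: le_anti.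
by apply/rectP; rewrite /= !lexx; move: uab; rewrite in_itv /= => ->.
Qed.

Lemma vsegment_connected a c d : connected (rect a a c d).
Proof.
rewrite (_ : rect a a c d = (fun t => (a, t)) @` `[c, d]).
  apply: connected_continuous_connected; first exact: segment_connected.
  apply: continuous_subspaceT => t; exact: cvg_pair (cvg_cst _) cvg_id.
apply/seteqP; split=> [[t s] /rectP/= [tab sc]|[t s] [u /= uab [<- <-]]].
  exists s; first by rewrite /= in_itv.
  by congr (_, _); apply: le_anti.
by apply/rectP; rewrite /= !lexx; move: uab; rewrite in_itv /= => ->.
Qed.

Variable F : R * R -> 'rV[R]_m.
Hypothesis Fcov : covered F (rect 0 1 0 1).
Hypothesis Fopen : support_open F (rect 0 1 0 1).
Hypothesis Fcoc : forall y, rect 0 1 0 1 y -> forall u v w,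
  F y 0 u != 0 -> F y 0 v != 0 -> F y 0 w != 0 -> e u w = (e v w * e u v)%g.

Let Fcov_sub (a b c d : R) : 0 <= a -> b <= 1 -> 0 <= c -> d <= 1 ->
  covered F (rect a b c d).
Proof. by move=> a0 b1 c0 d1 z zA; apply/Fcov/(rect_sub _ _ _ _ zA). Qed.

(** A vertex [v] in the support at [(x, y)] stays in the support nearby, so [e v] is a lift over
    each small rectangle there. *)
Let square_lift_local (x y : R) : 0 <= x <= 1 -> 0 <= y <= 1 ->
  exists2 r : R, 0 < r & forall a b c d : R,
    0 <= a -> b <= 1 -> x - r < a -> b < x + r ->
    0 <= c -> d <= 1 -> y - r < c -> d < y + r ->
    exists s, lift_on F (rect a b c d) s.
Proof.
move=> x01 y01; have xy : rect 0 1 0 1 (x, y) by apply/rectP.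
have [v Fv] := Fcov xy; have := Fopen xy Fv.
rewrite near_withinE => /nbhs_ballP[r /= r0 rP].
exists r => // a b c d a0 b1 xa bx c0 d1 yc dy.
have sub : rect a b c d `<=` rect 0 1 0 1 by exact: rect_sub.
exists (fun _ w => e v w); apply: lift_cst.
  move=> z w zA Fw; have := Fopen (sub _ zA) Fw.
  rewrite !near_withinE; apply: filterS => u + uA; apply; exact: sub.
move=> z w w' zA Fw Fw'; apply: Fcoc (sub _ zA) _ _ _ _ _ _ => //.
apply: rP; last exact: sub.
move: zA => /rectP[/andP[z1 z2] /andP[z3 z4]].
clear -xa bx yc dy z1 z2 z3 z4.
by split; rewrite /ball /= ltr_norml; apply/andP; split; lra.
Qed.

(** Rectangles are stacked vertically and glued along horizontal segments; one width [r] serves the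
    whole height, as each gluing takes the minimum of two widths. *)
Let strip_lift (x : R) : 0 <= x <= 1 ->
  exists2 r : R, 0 < r & forall a b : R,
    0 <= a -> b <= 1 -> x - r < a -> b < x + r -> a <= b -> exists s, lift_on F (rect a b 0 1) s.
Proof.
(* The bounds are premises inside [Q] because transitivity in [interval_induction] is asked for
   arbitrary endpoints. *)
move=> x01; pose Q c d := 0 <= c -> d <= 1 ->
  exists2 r : R, 0 < r & forall a b : R,
    0 <= a -> b <= 1 -> x - r < a -> b < x + r -> a <= b -> exists s, lift_on F (rect a b c d) s.
suff : Q 0 1 by apply.
apply: interval_induction => [c d f cd df Qcd Qdf c0 f1|y y01]; last first.
  have [r r0 rP] := square_lift_local x01 y01.
  exists r => // c d c0 cy yd d1 yc dy _ _; exists r => // a b a0 b1 xa bx ab.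
  exact: rP.
have [//||r1 r10 r1P] := Qcd; first exact: le_trans f1.
have [|//|r2 r20 r2P] := Qdf; first exact: le_trans cd.
exists (Num.min r1 r2); first by rewrite lt_min r10.
move=> a b a0 b1 xa bx ab.
have [|||s1 s1P] := r1P a b a0 b1.
- by apply: le_lt_trans xa; rewrite lerB // ge_min lexx.
- by apply: lt_le_trans bx _; rewrite lerD2l ge_min lexx.
- by [].
have [|||s2 s2P] := r2P a b a0 b1.
- by apply: le_lt_trans xa; rewrite lerB // ge_min lexx orbT.
- by apply: lt_le_trans bx _; rewrite lerD2l ge_min lexx orbT.
- by [].
rewrite (rectUv _ _ df cd).
apply: lift_glue s1P s2P; rewrite ?rectIv //.
- exact: rect_closed.
- exact: rect_closed.
- exact: hsegment_connected.
- by exists (a, d); apply/rectP => /=; rewrite !lexx.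
- by apply: Fcov_sub => //; [exact: le_trans cd|exact: le_trans f1].
Qed.

Lemma square_lift : exists s, lift_on F (rect 0 1 0 1) s.
Proof.
pose Q a b := 0 <= a -> b <= 1 -> exists s, lift_on F (rect a b 0 1) s.
suff : Q 0 1 by apply.
apply: interval_induction => [a b c ab bc Qab Qbc a0 c1|x x01]; last first.
  have [r r0 rP] := strip_lift x01.
  exists r => // a b a0 ax xb b1 xa bx _ _; apply: rP => //; exact: le_trans xb.
have [//||s1 s1P] := Qab; first exact: le_trans c1.
have [|//|s2 s2P] := Qbc; first exact: le_trans ab.
rewrite (rectU _ _ ab bc).
apply: lift_glue s1P s2P; rewrite ?rectI //.
- exact: rect_closed.
- exact: rect_closed.
- exact: vsegment_connected.
- by exists (b, 0); apply/rectP => /=; rewrite !lexx ler01.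
- by apply: Fcov_sub => //; [exact: le_trans ab|exact: le_trans c1].
Qed.

End Squares.
End Lifts.

(** * Inverses and concatenations of paths *)

Section PathAlgebra.
Local Open Scope ring_scope.
Variables (R : realType) (T : topologicalType) (X : set T).
Implicit Types (f g : R -> T) (x y z : T).

Local Notation I := (`[0, 1]%classic : set R).

Lemma unit_itvP (t : R) : I t <-> 0 <= t <= 1.
Proof. by rewrite /= in_itv. Qed.

Lemma affine_continuous (a b : R) (A : set R) :
  {within A, continuous (fun t => a * t + b)}.
Proof.
apply: continuous_subspaceT => t.
by apply: cvgD; [apply: cvgMr; exact: cvg_id|exact: cvg_cst].
Qed.

Lemma within_eq (U V : topologicalType) (A : set U) (f g : U -> V) :
  (forall t, A t -> f t = g t) ->
  {within A, continuous f} -> {within A, continuous g}.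
Proof. by move=> fg; apply: subspace_eq_continuous => t; rewrite inE => /fg. Qed.

Lemma within_comp (U V W : topologicalType) (A : set U) (B : set V)
    (h : U -> V) (f : V -> W) :
  {within A, continuous h} -> h @` A `<=` B -> {within B, continuous f} ->
  {within A, continuous (f \o h)}.
Proof.
move=> /subspace_continuousP hc hA /subspace_continuousP fc.
apply/subspace_continuousP => y Ay.
have Bhy : B (h y) by apply: hA; exists y.
apply: cvg_comp (fc _ Bhy) => Q nQ.
have hy : h @ within A (nbhs y) --> h y := hc _ Ay.
have : \forall z \near within A (nbhs y), B (h z) -> Q (h z) := hy _ nQ.
rewrite near_withinE => nA.
suff : \forall z \near within A (nbhs y), Q (h z) by [].
rewrite near_withinE.
by apply: filterS nA => z + Az => /(_ Az); apply; apply: hA; exists z.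
Qed.

Lemma is_path_inv f x y : is_path X f x y -> is_path X (path_inv f) y x.
Proof.
move=> [fc fX f0 f1]; split; rewrite /path_inv ?subr0 ?subrr //.
  apply: (within_comp (h := fun t : R => 1 - t)) fc.
    apply: (within_eq (f := fun t : R => -1 * t + 1)).
      by move=> t _; rewrite mulN1r addrC.
    exact: affine_continuous.
  by move=> _ [t /unit_itvP t01 <-]; apply/unit_itvP; lra.
move=> _ [t /unit_itvP t01 <-]; apply: fX; exists (1 - t) => //.
by apply/unit_itvP; lra.
Qed.

Lemma path_cat_split : I = `[0, 2^-1]%classic `|` `[2^-1, 1]%classic.
Proof.
apply/seteqP; split=> t; rewrite /setU /= !in_itv /=.
  by move=> /andP[t0 t1]; have [tb|/ltW tb] := leP t 2^-1; [left|right]; apply/andP.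
by move=> [] /andP[t0 t1]; apply/andP; split; lra.
Qed.

Lemma path_catE1 f g t : t <= 2^-1 -> path_cat f g t = f (2 * t).
Proof. by rewrite /path_cat => ->. Qed.

Lemma path_catE2 f g t : f 1 = g 0 -> 2^-1 <= t -> path_cat f g t = g (2 * t - 1).
Proof.
rewrite /path_cat => fg; case: ltgtP => // <- _.
by rewrite divff ?subrr // pnatr_eq0.
Qed.

Lemma is_path_cat f g x y z :
  is_path X f x y -> is_path X g y z -> is_path X (path_cat f g) x z.
Proof.
move=> [fc fX f0 f1] [gc gX g0 g1]; have fg : f 1 = g 0 by rewrite f1.
split.
- rewrite path_cat_split; apply: withinU_continuous; [exact: itv_closed..| |].
    apply: (within_eq (f := f \o (fun t : R => 2 * t + 0))).
      by move=> t; rewrite /= in_itv => /andP[_ t1]; rewrite addr0 [RHS]path_catE1.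
    apply: within_comp fc; first exact: affine_continuous.
    move=> _ [t /= + <-]; rewrite !in_itv /= => /andP[t1 t2].
    by apply/andP; split; lra.
  apply: (within_eq (f := g \o (fun t : R => 2 * t + -1))).
    by move=> t; rewrite /= in_itv => /andP[t1 _]; rewrite [RHS]path_catE2.
  apply: within_comp gc; first exact: affine_continuous.
  move=> _ [t /= + <-]; rewrite !in_itv /= => /andP[t1 t2].
  by apply/andP; split; lra.
- move=> _ [t /unit_itvP/andP[t0 t1] <-]; have [t2|/ltW t2] := leP t 2^-1.
    rewrite path_catE1 //; apply: fX; exists (2 * t) => //.
    by apply/unit_itvP; apply/andP; split; lra.
  rewrite path_catE2 //; apply: gX; exists (2 * t - 1) => //.
  by apply/unit_itvP; apply/andP; split; lra.
- by rewrite path_catE1 ?mulr0 // invr_ge0.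
- by rewrite path_catE2 // ?mulr1 ?(addrK 1) //; lra.
Qed.

Lemma is_path_cst x : X x -> is_path X (cst x : R -> T) x x.
Proof.
move=> Xx; split=> //; first by apply: continuous_subspaceT => t; exact: cvg_cst.
by move=> _ [t _ <-].
Qed.

Lemma same_component_sym x y : same_component R X x y -> same_component R X y x.
Proof. by move=> [f /is_path_inv fP]; eexists; exact: fP. Qed.

Lemma same_component_trans x y z :
  same_component R X x y -> same_component R X y z -> same_component R X x z.
Proof. by move=> [f fP] [g gP]; eexists; exact: is_path_cat fP gP. Qed.

End PathAlgebra.

(** * Transport along paths, its homotopy invariance, and holonomy *)

Section Transport.
Local Open Scope ring_scope.
Variables (R : realType) (m : nat) (K : {set {set 'I_m}}) (P : groupType).
Variable e : 'I_m -> 'I_m -> P.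
Hypothesis e_cocycle : forall (J : {set 'I_m}) u v w, J \in K ->
  u \in J -> v \in J -> w \in J -> e u w = (e v w * e u v)%g.
Hypothesis K_closed : forall I J : {set 'I_m}, I \in K -> J \subset I -> J \in K.

Local Notation I := (`[0, 1]%classic : set R).
Local Notation X := (realization R K).
Implicit Types (f g : R -> 'rV[R]_m) (i j k : 'I_m) (p q r c : P).

(** At a vertex the support is a single index, so the fibre there is a copy of [P]: a lift of [f]
    leads from [p] over vertex [i] to [q] over vertex [j]. *)
Definition transport f i p j q := exists s,
  [/\ lift_on e f I s, f 0 = vertex R i, f 1 = vertex R j, s 0 i = p & s 1 j = q].

Lemma vertex_supp i v : (vertex R i 0 v != 0) = (v == i).
Proof. by rewrite mxE /=; case: (v == i); rewrite ?oner_eq0 ?eqxx. Qed.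

Lemma realization_cocycle x : X x -> forall u v w,
  x 0 u != 0 -> x 0 v != 0 -> x 0 w != 0 -> e u w = (e v w * e u v)%g.
Proof.
by move=> [_ _ xK] u v w xu xv xw; apply: e_cocycle xK _ _ _; rewrite inE.
Qed.

Lemma realization_supp x : X x -> exists v, x 0 v != 0.
Proof.
move=> [_ x1 _]; apply/existsP; apply: contra_eqT x1.
rewrite negb_exists => /forallP x0; rewrite big1 => [|v _].
  by rewrite eq_sym oner_eq0.
by have := x0 v; rewrite negbK => /eqP.
Qed.

Lemma path_covered f x y : is_path X f x y -> covered f I.
Proof. by move=> [_ fX _ _] t It; apply: realization_supp; apply: fX; exists t. Qed.

Lemma unit_itv0 : I 0. Proof. by apply/unit_itvP; rewrite lexx ler01. Qed.
Lemma unit_itv1 : I 1. Proof. by apply/unit_itvP; rewrite lexx ler01. Qed.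

Lemma squareE : I `*` I = rect 0 1 0 1 :> set (R * R).
Proof. by []. Qed.

Lemma homotopy_lift (H : R * R -> 'rV[R]_m) :
  {within I `*` I, continuous H} -> H @` (I `*` I) `<=` X ->
  exists s, lift_on e H (I `*` I) s.
Proof.
move=> Hc HX; rewrite squareE; apply: square_lift.
- by move=> y yI; apply: realization_supp; apply: HX; exists y.
- exact: continuous_support_open.
- by move=> y yI; apply: realization_cocycle; apply: HX; exists y.
Qed.

Lemma fst_within (A : set (R * R)) : {within A, continuous fst}.
Proof. by apply: continuous_subspaceT => z; exact: cvg_fst. Qed.

Lemma pairl_within (a : R) (A : set R) : {within A, continuous (fun t => (t, a))}.
Proof. by apply: continuous_subspaceT => z; exact: cvg_pair cvg_id (cvg_cst _). Qed.

Lemma pairr_within (a : R) (A : set R) : {within A, continuous (fun t => (a, t))}.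
Proof. by apply: continuous_subspaceT => z; exact: cvg_pair (cvg_cst _) cvg_id. Qed.

Lemma transport_mulr f i p j q c :
  transport f i p j q -> transport f i (p * c)%g j (q * c)%g.
Proof.
move=> [s [sP f0 f1 <- <-]]; exists (fun y v => s y v * c)%g.
by split=> //; exact: lift_mulr.
Qed.

Lemma transport_exists f i p j :
  is_path X f (vertex R i) (vertex R j) -> exists q, transport f i p j q.
Proof.
move=> [fc fX f0 f1].
(* A path is lifted as a homotopy that is constant in the second variable. *)
have [||s sP] := @homotopy_lift (f \o fst).
- by apply: within_comp fc; [exact: fst_within|move=> _ [z [z1 _] <-]].
- by move=> _ [z [z1 _] <-]; apply: fX; exists z.1.
have {}sP : lift_on e f I (fun t => s (t, 0)).
  apply: (lift_comp (F := f \o fst) (h := fun t => (t, 0)) _ _ sP).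
    exact: pairl_within.
  by move=> _ [t It <-]; split=> //=; exact: unit_itv0.
exists (s (1%R, 0%R) j * ((s (0%R, 0%R) i)^-1 * p))%g.
rewrite -{1}(mulVKg (s (0, 0) i) p); apply: transport_mulr.
by exists (fun t => s (t, 0)); split.
Qed.

Lemma transport_unique f i p j q q' : is_path X f (vertex R i) (vertex R j) ->
  transport f i p j q -> transport f i p j q' -> q = q'.
Proof.
move=> fP [s [sP f0 f1 s0 <-]] [s' [s'P _ _ s'0 <-]].
apply: (lift_unique _ (path_covered fP) sP s'P unit_itv0 _ _ unit_itv1).
- exact: segment_connected.
- by rewrite f0 vertex_supp.
- by rewrite s0 s'0.
- by rewrite f1 vertex_supp.
Qed.

Lemma transport_cst i p : [set i]%SET \in K -> transport (cst (vertex R i)) i p i p.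
Proof.
move=> iK; exists (fun=> fun v => e i v * p)%g.
have e1 : e i i = 1%g.
  have iI : i \in [set i]%SET by rewrite inE.
  (* The cocycle identity makes [e i i] idempotent, hence 1. *)
  by have := e_cocycle iK iI iI iI; rewrite -{1}[e i i]mulg1 => /mulgI/esym.
split=> //; last by rewrite e1 mul1g.
  2: by rewrite e1 mul1g.
apply: lift_mulr; apply: lift_cst.
  by apply: continuous_support_open; apply: continuous_subspaceT => t; exact: cvg_cst.
move=> t w w' _; rewrite !vertex_supp => /eqP -> /eqP ->.
by rewrite e1 mulg1.
Qed.

Lemma transport_inv f i p j q :
  transport f i p j q -> transport (path_inv f) j q i p.
Proof.
move=> [s [sP f0 f1 <- <-]]; exists (s \o (fun t => 1 - t)).
rewrite /path_inv /= subr0 subrr; split=> //.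
apply: (lift_comp (h := fun t : R => 1 - t) _ _ sP).
  apply: (within_eq (f := fun t : R => -1 * t + 1)).
    by move=> t _; rewrite mulN1r addrC.
  exact: affine_continuous.
by move=> _ [t /unit_itvP t01 <-]; apply/unit_itvP; lra.
Qed.

Lemma transport_cat f g i p j q k r :
  transport f i p j q -> transport g j q k r -> transport (path_cat f g) i p k r.
Proof.
move=> [s [sP f0 f1 <- <-]] [s' [s'P g0 g1 s'0 <-]].
have fg : f 1 = g 0 by rewrite f1.
pose t1 (t : R) := 2 * t + 0; pose t2 (t : R) := 2 * t + -1.
have A1 : lift_on e (path_cat f g) `[0, 2^-1]%classic (s \o t1).
  apply: (lift_eq (F := f \o t1) (s := s \o t1)) => //.
    by move=> t; rewrite /= in_itv /= => /andP[_ tb]; rewrite path_catE1 // /t1 addr0.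
  apply: lift_comp sP; first exact: affine_continuous.
  move=> _ [t /= + <-]; rewrite /t1 !in_itv /= => /andP[? ?].
  by apply/andP; split; lra.
have A2 : lift_on e (path_cat f g) `[2^-1, 1]%classic (s' \o t2).
  apply: (lift_eq (F := g \o t2) (s := s' \o t2)) => //.
    by move=> t; rewrite /= in_itv /= => /andP[tb _]; rewrite path_catE2.
  apply: lift_comp s'P; first exact: affine_continuous.
  move=> _ [t /= + <-]; rewrite /t2 !in_itv /= => /andP[? ?].
  by apply/andP; split; lra.
have half : 2 * 2^-1 = 1 :> R by rewrite divff ?pnatr_eq0.
eexists; split.
- rewrite path_cat_split; apply: lift_glue_eq A1 A2 _; [exact: itv_closed..|].
  move=> t v /=; rewrite !in_itv /= => /andP[_ tb] /andP[ta _].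
  have -> : t = 2^-1 by apply/le_anti; rewrite tb.
  rewrite path_catE1 // half f1 vertex_supp /t1 /t2 half addr0 subrr => /eqP ->.
  by rewrite s'0.
- by rewrite path_catE1 ?mulr0 // invr_ge0.
- by rewrite path_catE2 // ?mulr1 ?(addrK 1) //; lra.
- rewrite /= mem_set /t1 ?mulr0 ?addr0 //.
  by rewrite /= in_itv /=; apply/andP; split; lra.
- rewrite /= memNset /t2 ?mulr1 ?(addrK 1) //.
  by rewrite /= in_itv /= => /andP[_]; lra.
Qed.

Lemma transport_segment i j p : [set i; j]%SET \in K ->
  transport (segment (vertex R i) (vertex R j)) i p j (e i j * p)%g.
Proof.
move=> ijK.
have iI : i \in [set i; j]%SET by rewrite !inE eqxx.
have jI : j \in [set i; j]%SET by rewrite !inE eqxx orbT.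
have e1 : e i i = 1%g.
  by have := e_cocycle ijK iI iI iI; rewrite -{1}[e i i]mulg1 => /mulgI/esym.
have supp t v : segment (vertex R i) (vertex R j) t 0 v != 0 -> v \in [set i; j]%SET.
  rewrite !mxE /= !inE; case: (v == i); case: (v == j) => //=.
  by rewrite !mulr0 addr0 eqxx.
exists (fun=> fun v => e i v * p)%g; split=> //; last by rewrite e1 mul1g.
- apply: lift_mulr; apply: lift_cst => [|t w w' _ /supp wI /supp w'I].
    apply: continuous_support_open; apply: continuous_subspaceT => t.
    rewrite /segment; apply: cvgD; apply: cvgZl; last exact: cvg_id.
    by apply: cvgB; [exact: cvg_cst|exact: cvg_id].
  exact: e_cocycle ijK iI wI w'I.
- by rewrite /segment subr0 scale1r scale0r addr0.
- by rewrite /segment subrr scale1r scale0r add0r.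
Qed.

(** Each edge acts by left multiplication, so the factor of the first edge is written last. *)
Definition holonomy i (l : seq 'I_m) : P :=
  (\prod_(x <- rev (zip (i :: l) l)) e x.1 x.2)%g.

Lemma holonomy_cons i j l : holonomy i (j :: l) = (holonomy j l * e i j)%g.
Proof. by rewrite /holonomy /= rev_cons -cats1 big_cat big_seq1. Qed.

Lemma transport_edge_path i l p : [set i]%SET \in K -> path (edge K) i l ->
  transport (edge_path R i l) i p (last i l) (holonomy i l * p)%g.
Proof.
elim: l i p => [|j l IH] i p iK /=.
  by move=> _; rewrite /holonomy big_nil mul1g; exact: transport_cst.
move=> /andP[/andP[_ ijK] lP].
have jK : [set j]%SET \in K.
  by apply: K_closed ijK _; rewrite finset.sub1set !inE eqxx orbT.
rewrite holonomy_cons -mulgA; apply: transport_cat (transport_segment _ ijK) _.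
exact: IH.
Qed.

Lemma vertex_realization i : [set i]%SET \in K -> X (vertex R i).
Proof.
move=> iK; split.
- by move=> v; rewrite mxE ler0n.
- rewrite (bigD1 i) //= big1 ?addr0 ?mxE ?eqxx // => v vi.
  by rewrite mxE eqxx /= (negbTE vi).
- suff -> : [set v | vertex R i 0 v != 0]%SET = [set i]%SET by [].
  by apply/setP => v; rewrite !inE vertex_supp.
Qed.

Lemma is_path_segment i j : [set i; j]%SET \in K ->
  is_path X (segment (vertex R i) (vertex R j)) (vertex R i) (vertex R j).
Proof.
move=> ijK; split.
- apply: continuous_subspaceT => t.
  rewrite /segment; apply: cvgD; apply: cvgZl; last exact: cvg_id.
  by apply: cvgB; [exact: cvg_cst|exact: cvg_id].
- move=> _ [t /unit_itvP/andP[t0 t1] <-]; split.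
  + by move=> v; rewrite !mxE /= addr_ge0 // mulr_ge0 // ?ler0n // subr_ge0.
  + under eq_bigr => v _ do rewrite !mxE /=.
    rewrite big_split /= -!big_distrr /=.
    have d k : \sum_v ((v == k)%:R : R) = 1.
      by rewrite (bigD1 k) //= big1 ?eqxx ?addr0 // => v /negbTE ->.
    by rewrite !d !mulr1 subrK.
  + apply: K_closed ijK _; apply/fintype.subsetP => v.
    rewrite !inE !mxE /=; case: (v == i); case: (v == j) => //=.
    by rewrite !mulr0 addr0 eqxx.
- by rewrite /segment subr0 scale1r scale0r addr0.
- by rewrite /segment subrr scale1r scale0r add0r.
Qed.

Lemma is_path_edge_path i l : [set i]%SET \in K -> path (edge K) i l ->
  is_path X (edge_path R i l) (vertex R i) (vertex R (last i l)).
Proof.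
elim: l i => [|j l IH] i iK /=.
  by move=> _; apply: is_path_cst; exact: vertex_realization.
move=> /andP[/andP[_ ijK] lP].
have jK : [set j]%SET \in K.
  by apply: K_closed ijK _; rewrite finset.sub1set !inE eqxx orbT.
by apply: is_path_cat (is_path_segment ijK) _; exact: IH.
Qed.

(** The homotopy lifts to the square. Along the vertical sides it stays at the vertex [i], so the
    lift is constant there, and the top side closes up because the bottom side does. *)
Lemma transport_homotopic f g i p : path_homotopic X f g ->
  transport f i p i p -> transport g i p i p.
Proof.
move=> [H [Hc HX Hfg Hend]] [s [sP f0 f1 s0 s1]].
have [t tP] := homotopy_lift Hc HX.
have Xsq z : (I `*` I) z -> X (H z) by move=> zI; apply: HX; exists z.
have bot a (Ia : I a) : lift_on e (fun x => H (x, a)) I (fun x => t (x, a)).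
  apply: (lift_comp (h := fun x => (x, a)) _ _ tP); first exact: pairl_within.
  by move=> _ [x Ix <-].
have side a (Ia : I a) (Hi : forall x, I x -> H (a, x) = vertex R i) :
    t (a, 0) i = t (a, 1) i.
  have st : lift_on e (fun x => H (a, x)) I (fun x => t (a, x)).
    apply: (lift_comp (h := fun x => (a, x)) _ _ tP); first exact: pairr_within.
    by move=> _ [x Ix <-].
  (* The constant continuation of the lower corner is a lift of the side as well, so uniqueness
     applies. *)
  have cs : lift_on e (fun x => H (a, x)) I (fun=> t (a, 0)).
    move=> y Iy; split.
      by move=> v w; rewrite Hi // !vertex_supp => /eqP -> /eqP ->;
        apply: ((st _ unit_itv0).1); rewrite Hi ?vertex_supp //; exact: unit_itv0.
    move=> v Hv; rewrite near_withinE; apply: filterE => z Iz.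
    by rewrite Hi // -(Hi _ Iy).
  have cov : covered (fun x => H (a, x)) I.
    by move=> x Ix; apply: realization_supp; exact: Xsq.
  apply: (lift_unique _ cov cs st unit_itv0 _ _ unit_itv1) => //.
    exact: segment_connected.
    by rewrite Hi ?vertex_supp //; exact: unit_itv0.
  by rewrite Hi ?vertex_supp //; exact: unit_itv1.
have H0 x : I x -> H (0, x) = vertex R i by move=> Ix; rewrite (Hend _ Ix).1 f0.
have H1 x : I x -> H (1, x) = vertex R i by move=> Ix; rewrite (Hend _ Ix).2 f1.
(* Up to a deck transformation the bottom side of the lift is [s], which has the same value [p] at
   both ends. *)
have t01 : t (0, 0) i = t (1, 0) i.
  have cov : covered (fun x => H (x, 0)) I.
    by move=> x Ix; apply: realization_supp; apply: Xsq; split=> //; exact: unit_itv0.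
  have sP' : lift_on e (fun x => H (x, 0)) I
      (fun y v => s y v * (p^-1 * t (0%R, 0%R) i))%g.
    apply: lift_mulr; apply: lift_eq sP => // x Ix; exact/esym/(Hfg _ Ix).1.
  suff : (s 1%R i * (p^-1 * t (0%R, 0%R) i))%g = t (1, 0) i by rewrite s1 mulVKg.
  apply: (lift_unique (v0 := i) (@segment_connected _ 0 1) cov sP' (bot _ unit_itv0)
    unit_itv0 _ _ unit_itv1).
  - by rewrite (H0 _ unit_itv0) vertex_supp.
  - by rewrite s0 mulVKg.
  - by rewrite (H1 _ unit_itv0) vertex_supp.
exists (fun y v => t (y, 1%R) v * ((t (0%R, 0%R) i)^-1 * p))%g; split.
- apply: lift_mulr; apply: lift_eq (bot _ unit_itv1) => // x Ix.
  exact: (Hfg _ Ix).2.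
- by rewrite -(Hfg _ unit_itv0).2 H0 //; exact: unit_itv1.
- by rewrite -(Hfg _ unit_itv1).2 H1 //; exact: unit_itv1.
- by rewrite -side ?mulVKg //; exact: unit_itv0.
- by rewrite -side -?t01 ?mulVKg //; exact: unit_itv1.
Qed.

Lemma transport_generated (S : set (R -> 'rV[R]_m)) b f : [set b]%SET \in K ->
  (forall f, S f -> transport f b 1%g b 1%g) ->
  generated_loops X (vertex R b) S f -> transport f b 1%g b 1%g.
Proof.
move=> bK SP; elim=> {f} [f /SP //||f _ fP|f g _ fP _ gP|f g _ fP fg].
- exact: transport_cst.
- exact: transport_inv.
- exact: transport_cat fP gP.
- exact: transport_homotopic fg fP.
Qed.

(** A path [h] from [i] to the base vertex [b] of its component conjugates the loop to one at [b],
    which has trivial transport by generation. With [r] the transport of [h], this reads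
    [r * q * r^-1 = 1]. *)
Lemma generates_Pi1_transport (C : set (seq 'I_m)) :
  generates_Pi1 R K C -> (forall s, C s -> is_cycle K s) ->
  (forall b l, C (b :: l) -> holonomy b l = 1%g) ->
  forall i f q, is_path X f (vertex R i) (vertex R i) ->
  transport f i 1%g i q -> q = 1%g.
Proof.
move=> [B [Brep CB gen]] Ccyc Chol i f q fP fT.
have Xi : X (vertex R i).
  by case: fP => _ fX <- _; apply: fX; exists 0 => //; exact: unit_itv0.
have vK j : X (vertex R j) -> [set j]%SET \in K.
  move=> [_ _]; suff -> : [set v | vertex R j 0 v != 0]%SET = [set j]%SET by [].
  by apply/setP => v; rewrite !inE vertex_supp.
have [b [[Bb [h hP]] _]] := Brep _ Xi.
have bK : [set b]%SET \in K.
  by apply: vK; case: hP => _ hX _ <-; apply: hX; exists 1 => //; exact: unit_itv1.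
have [r hT] := transport_exists 1%g hP.
have := transport_mulr r^-1%g hT; rewrite mulgV mul1g => /transport_inv hVT.
have := transport_mulr r^-1%g fT; rewrite mul1g => frT.
have := transport_mulr (q * r^-1)%g hT; rewrite mul1g => hqT.
have loopP := is_path_cat (is_path_inv hP) (is_path_cat fP hP).
have loopT := transport_cat hVT (transport_cat frT hqT).
have /(transport_unique loopP loopT) : transport (path_cat (path_inv h) (path_cat f h))
    b 1%g b 1%g.
  apply: transport_generated (gen _ _ Bb loopP) => // _ [l /= Cl <-].
  have := Ccyc _ Cl; rewrite /= => /and3P[_ lP /eqP lb].
  by have := transport_edge_path 1%g bK lP; rewrite lb Chol // mul1g.
by rewrite mulgA => /divg1_eq e1; apply: (@mulgI _ r); rewrite e1 mulg1.
Qed.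

End Transport.

(** * Reduced homology in degree 0 *)

Section ReducedH0.
Local Open Scope ring_scope.
Variables (R : realType) (T : topologicalType) (X : set T).
Implicit Types (c : T -> rat) (h : T -> rat) (l : seq (rat * T)).

Definition combination l : T -> rat :=
  fun y => \sum_(p <- l) p.1 * point_chain p.2 y.

(** The evaluation of the 0-cochain [h] on the chain [c]. *)
Definition weight h c : rat := \sum_(x \in [set: T]) c x * h x.

Lemma weight_combination h l :
  weight h (combination l) = \sum_(p <- l) p.1 * h p.2.
Proof.
pose s := undup [seq p.2 | p <- l].
have sl p : p \in l -> p.2 \in s by move=> pl; rewrite mem_undup map_f.
rewrite /weight (fsbigE s) ?undup_uniq //= => [|x _ xs]; last first.
  rewrite /combination big_seq big1 ?mul0r // => p /sl ps.
  by rewrite /point_chain; case: eqVneq xs => [->|]; rewrite ?ps ?mulr0.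
rewrite (eq_bigl xpredT) => [|x]; last by rewrite in_setT.
rewrite /combination; under eq_bigr do rewrite big_distrl /=.
rewrite exchange_big /= big_seq [RHS]big_seq; apply: eq_bigr => p /sl ps.
rewrite (bigD1_seq p.2) ?undup_uniq //= /point_chain eqxx mulr1.
by rewrite big1 ?addr0 // => x /negbTE ->; rewrite mulr0 mul0r.
Qed.

Lemma combination_chain l : (forall p, p \in l -> X p.2) -> chain0 X (combination l).
Proof.
move=> lX.
have sub : [set x | combination l x != 0] `<=` [set` [seq p.2 | p <- l]].
  move=> x /=; apply: contraNT => xl; rewrite /combination big_seq big1 // => p pl.
  rewrite /point_chain; case: eqVneq xl => [->|]; rewrite ?mulr0 //.
  by rewrite map_f.
split; first exact: sub_finite_set sub (finite_seq _).
by move=> x /sub /= /mapP[p /lX pX ->].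
Qed.

Lemma chain_combination c : chain0 X c ->
  exists2 l, c = combination l & forall p, p \in l -> X p.2 /\ p.1 = c p.2.
Proof.
move=> [/finite_seqP[s cs] cX]; have csE x : (c x != 0) = (x \in s).
  by have /seteqP[c1 c2] := cs; apply/idP/idP => [/c1|/c2].
exists [seq (c x, x) | x <- undup s].
  apply/funext => y; rewrite /combination big_map /=.
  have [cy|cy] := eqVneq (c y) 0.
    rewrite cy big1 // => x _; rewrite /point_chain.
    by case: eqVneq cy => [->->|]; rewrite ?mul0r ?mulr0.
  rewrite (bigD1_seq y) ?undup_uniq //=; last by rewrite mem_undup -csE.
  rewrite /point_chain eqxx mulr1 big1 ?addr0 // => x /negbTE.
  by rewrite eq_sym => ->; rewrite mulr0.
move=> _ /mapP[x + ->] /=; rewrite mem_undup -csE => cx.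
by split=> //; exact: cX.
Qed.

Lemma sub_sum_combination n l (a : 'I_n -> rat) (lz : 'I_n -> seq (rat * T)) :
  (fun y => combination l y - \sum_(i < n) a i * combination (lz i) y) =
  combination (l ++ flatten
    [seq [seq (- a i * p.1, p.2) | p <- lz i] | i <- enum 'I_n]).
Proof.
apply/funext => y; rewrite /combination big_cat big_flatten big_map /=.
rewrite big_enum /= -sumrN; congr (_ + _); apply: eq_bigr => i _.
by rewrite big_map big_distrr -sumrN; apply: eq_bigr => p _; rewrite /= !mulNr mulrA.
Qed.

Lemma weight_sub_sum n h c (a : 'I_n -> rat) (z : 'I_n -> T -> rat) :
  chain0 X c -> (forall i, chain0 X (z i)) ->
  chain0 X (fun y => c y - \sum_(i < n) a i * z i y) /\
  weight h (fun y => c y - \sum_(i < n) a i * z i y) =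
    weight h c - \sum_(i < n) a i * weight h (z i).
Proof.
move=> /chain_combination[l -> lX] zX.
have /choice[lz lzP] : forall i, exists lz, z i = combination lz /\
    forall p, p \in lz -> X p.2.
  move=> i; have [lz e lzX] := chain_combination (zX i).
  by exists lz; split=> // p /lzX[].
have -> : z = fun i => combination (lz i) by apply/funext => i; case: (lzP i).
rewrite sub_sum_combination; split.
  apply: combination_chain => p; rewrite mem_cat => /orP[/lX[]//|].
  by move=> /flatten_mapP[i _ /mapP[q /(lzP i).2 qX ->]].
rewrite !weight_combination big_cat big_flatten big_map big_enum /= -sumrN.
congr (_ + _); apply: eq_bigr => i _; rewrite big_map weight_combination.
by rewrite big_distrr -sumrN; apply: eq_bigr => p _; rewrite /= !mulNr mulrA.
Qed.

Lemma weight_boundary h c :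
  (forall f x y, is_path X (f : R -> T) x y -> h x = h y) ->
  boundary0 R X c -> weight h c = 0.
Proof.
move=> hP [n [a [f [fP ->]]]].
have -> : (fun y => \sum_(i < n)
      a i * (point_chain (f i 1) y - point_chain (f i 0) y)) =
    combination (flatten [seq [:: (a i, f i 1); (- a i, f i 0)] | i <- enum 'I_n]).
  apply/funext => y; rewrite /combination big_flatten big_map big_enum /=.
  by apply: eq_bigr => i _; rewrite big_cons big_seq1 /= mulNr mulrBr.
rewrite weight_combination big_flatten big_map big_enum /= big1 // => i _.
by rewrite big_cons big_seq1 /= (hP _ _ _ (fP i)) mulNr addrN.
Qed.

Section Representatives.
Variables (n : nat) (r : T) (w : 'I_n -> T).
(** Membership of [r] is stated under the quantifier so as to cover an empty [X], where [n] is 0 and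
    no root exists. *)
Hypothesis Xrw : forall i, X r /\ X (w i).
Hypothesis rep_exists : forall x, X x ->
  same_component R X x r \/ exists i, same_component R X x (w i).
Hypothesis rep_root : forall i, ~ same_component R X r (w i).
Hypothesis rep_inj : forall i j, same_component R X (w i) (w j) -> i = j.

(** These indicators of components vanish on boundaries and are dual to the cycles [rep_cycle]. *)
Definition chi k : T -> rat := fun x => (`[< same_component R X x (w k) >])%:R.
Definition rep_cycle (i : 'I_n) : T -> rat :=
  fun y => point_chain (w i) y - point_chain r y.

Lemma chi_path k f x y : is_path X (f : R -> T) x y -> chi k x = chi k y.
Proof.
move=> fP; have xy : same_component R X x y by exists f.
congr (_%:R); congr nat_of_bool; apply/asboolP/asboolP.
  by apply: same_component_trans; exact: same_component_sym.
exact: same_component_trans.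
Qed.

Lemma chi_rep k i : chi k (w i) = (i == k)%:R.
Proof.
congr (_%:R); congr nat_of_bool; apply/asboolP/eqP => [/rep_inj//|->].
by exists (cst (w k)); apply: is_path_cst; case: (Xrw k).
Qed.

Lemma chi_root k : chi k r = 0.
Proof. by rewrite /chi; case: asboolP => // /rep_root. Qed.

Lemma rep_cycleE i : rep_cycle i = combination [:: (1, w i); (-1, r)].
Proof.
by apply/funext => y; rewrite /combination big_cons big_seq1 /= mul1r mulN1r.
Qed.

Lemma reduced_cycleE c : reduced_cycle0 X c <-> chain0 X c /\ weight (fun=> 1) c = 0.
Proof.
rewrite /reduced_cycle0 /weight /=.
by under [in X in _ <-> X]eq_fsbigr => x _ do rewrite mulr1.
Qed.

Lemma rep_cycleP i : reduced_cycle0 X (rep_cycle i).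
Proof.
apply/reduced_cycleE; rewrite rep_cycleE weight_combination; split; last first.
  by rewrite big_cons big_seq1 /= !mulr1 subrr.
apply: combination_chain => p; rewrite !inE.
by have [? ?] := Xrw i; move=> /orP[]/eqP ->.
Qed.

Lemma weight_rep_cycle k i : weight (chi k) (rep_cycle i) = (i == k)%:R.
Proof.
by rewrite rep_cycleE weight_combination big_cons big_seq1 /= chi_rep chi_root
  mulr0 addr0 mul1r.
Qed.

(** Each point of [c] is joined by a path to the representative of its component. The boundaries of
    these paths add up to the given chain: the multiples of the root that occur cancel because the
    coefficients of [c] sum to 0. *)
Lemma cycle_boundary c : reduced_cycle0 X c ->
  boundary0 R X (fun y => c y - \sum_(i < n) weight (chi i) c * rep_cycle i y).
Proof.
move=> /reduced_cycleE[/chain_combination[l -> lX]].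
rewrite weight_combination => l0.
have /choice[g gP] : forall x, exists g : R -> T, X x ->
    (g 0 = r \/ exists k, g 0 = w k) /\ is_path X g (g 0) x.
  move=> x; have [Xx|nXx] := pselect (X x); last by exists (cst x).
  have [y yrep [g gP]] : exists2 y, y = r \/ exists k, y = w k & same_component R X y x.
    case: (rep_exists Xx) => [/same_component_sym xr|[k /same_component_sym xw]].
      by exists r => //; left.
    by exists (w k) => //; right; exists k.
  by exists g => _; have [_ _ -> _] := gP.
have gE x y : X x -> \sum_(i < n) chi i x * rep_cycle i y =
    point_chain (g x 0) y - point_chain r y.
  move=> Xx; have [rep gx] := gP x Xx.
  rewrite (eq_bigr (fun i => chi i (g x 0) * rep_cycle i y)) => [|i _]; last first.
    by rewrite (chi_path i gx).
  case: rep => [->|[k ->]].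
    by rewrite subrr big1 // => i _; rewrite chi_root mul0r.
  rewrite (bigD1 k) //= chi_rep eqxx mul1r big1 ?addr0 // => i /negbTE ik.
  by rewrite chi_rep eq_sym ik mul0r.
pose p i := tnth (in_tuple l) i.
exists (size l), (fun i => (p i).1), (fun i => g (p i).2); split=> [i|].
  have [Xp _] := lX _ (mem_tnth i (in_tuple l)).
  by have [_ gp] := gP _ Xp; case: (gp) => _ _ _ ->.
apply/funext => y.
transitivity (\sum_(p <- l) p.1 * (point_chain p.2 y - point_chain (g p.2 0) y)).
  under [X in _ - X]eq_bigr => i _ do rewrite weight_combination big_distrl /=.
  rewrite exchange_big /=.
  rewrite (eq_big_seq (fun p => p.1 * point_chain (g p.2 0) y -
    p.1 * 1 * point_chain r y)) => [|q ql]; last first.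
    rewrite mulr1 -mulrBr -gE; last by case: (lX _ ql).
    by rewrite big_distrr; apply: eq_bigr => i _; rewrite /= mulrA.
  rewrite sumrB -(big_distrl _ _ (fun q => q.1 * 1)) /= l0 mul0r subr0 -sumrB.
  by apply: eq_bigr => q _; rewrite mulrBr.
rewrite big_tnth; apply: eq_bigr => i _.
have [Xp _] := lX _ (mem_tnth i (in_tuple l)).
by have [_ [_ _ _ ->]] := gP _ Xp.
Qed.

Lemma boundaryP c : reduced_cycle0 X c ->
  boundary0 R X c <-> forall k, weight (chi k) c = 0.
Proof.
move=> cP; split=> [bc k|c0].
  by apply: weight_boundary bc => f x y; exact: chi_path.
suff <- : (fun y => c y - \sum_(i < n) weight (chi i) c * rep_cycle i y) = c.
  exact: cycle_boundary.
by apply/funext => y; rewrite big1 ?subr0 // => i _; rewrite c0 mul0r.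
Qed.

Lemma boundary_sub_sumP n' c (a : 'I_n' -> rat) (z : 'I_n' -> T -> rat) :
  reduced_cycle0 X c -> (forall i, reduced_cycle0 X (z i)) ->
  boundary0 R X (fun y => c y - \sum_(i < n') a i * z i y) <->
  forall k, weight (chi k) c = \sum_(i < n') a i * weight (chi k) (z i).
Proof.
move=> cP zP.
have cC : chain0 X c by case: cP.
have zC i : chain0 X (z i) by case: (zP i).
rewrite boundaryP; last first.
  apply/reduced_cycleE; have [? ->] := weight_sub_sum (fun=> 1) a cC zC.
  split=> //; case/reduced_cycleE: cP => _ ->; rewrite big1 ?subr0 // => i _.
  by case/reduced_cycleE: (zP i) => _ ->; rewrite mulr0.
split=> e k; have := e k; have [_ ->] := weight_sub_sum (chi k) a cC zC.
  by move/eqP; rewrite subr_eq0 => /eqP.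
by move=> ->; rewrite subrr.
Qed.

Lemma zero_cycle : reduced_cycle0 X (fun=> 0 : rat).
Proof.
have -> : (fun=> 0) = combination [::] by apply/funext => y; rewrite /combination big_nil.
apply/reduced_cycleE; rewrite weight_combination big_nil; split=> //.
exact: combination_chain.
Qed.

Lemma reduced_H0_dim_rep : reduced_H0_dim R X n.
Proof.
exists rep_cycle; split=> [|c cP]; first exact: rep_cycleP.
have wE (a : 'I_n -> rat) k : \sum_(i < n) a i * weight (chi k) (rep_cycle i) = a k.
  rewrite (bigD1 k) //= weight_rep_cycle eqxx mulr1 big1 ?addr0 // => i ik.
  by rewrite weight_rep_cycle (negbTE ik) mulr0.
exists (fun k => weight (chi k) c); split=> [|a].
  by apply/boundary_sub_sumP => // [|k]; [exact: rep_cycleP|rewrite wE].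
move=> /(boundary_sub_sumP _ cP rep_cycleP) e; apply/funext => k.
by rewrite e wE.
Qed.

(* As the boundaries are the cycles on which all [weight (chi k)] vanish, a
   family [z] as in [reduced_H0_dim] is given by an invertible matrix. *)
Lemma reduced_H0_dim_unique n' : reduced_H0_dim R X n' -> n' = n.
Proof.
move=> [z [zP zex]].
pose M : 'M[rat]_(n', n) := \matrix_(i, k) weight (chi k) (z i).
have Mex c : reduced_cycle0 X c -> exists a : 'rV_n', a *m M = \row_k weight (chi k) c.
  move=> cP; have [a [/(boundary_sub_sumP _ cP zP) e _]] := zex c cP.
  exists (\row_i a i); apply/rowP => k; rewrite !mxE e.
  by apply: eq_bigr => i _; rewrite !mxE.
(* A row vector killed by [M] gives coefficients for the zero cycle, and these are unique. *)
have Mfree : row_free M.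
  apply: inj_row_free => v vM; have [a [_ au]] := zex _ zero_cycle.
  have w0 k : weight (chi k) (fun=> 0) = 0.
    by rewrite /weight fsbig1 // => x _; rewrite mul0r.
  have av : a = (fun i => v 0 i).
    apply: au; apply/(boundary_sub_sumP _ zero_cycle zP) => k; rewrite w0.
    transitivity ((v *m M) 0 k); first by rewrite vM mxE.
    by rewrite mxE; apply: eq_bigr => i _; rewrite !mxE.
  have a0 : a = (fun=> 0).
    apply: au; apply/(boundary_sub_sumP _ zero_cycle zP) => k; rewrite w0.
    by rewrite big1 // => i _; rewrite mul0r.
  by apply/rowP => i; rewrite mxE; have := congr1 (@^~ i) av; rewrite a0.
(* The cycles [rep_cycle i] are expressed through [z], and their weights are the rows of the
   identity matrix. *)
have Mfull : row_full M.
  apply/row_fullP; have /choice[a aP] : forall i, exists a : 'rV_n', a *m M = row i 1%:M.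
    move=> i; have [a aE] := Mex _ (rep_cycleP i); exists a; rewrite aE.
    by apply/rowP => k; rewrite !mxE weight_rep_cycle.
  exists (\matrix_i a i); apply/row_matrixP => i.
  by rewrite row_mul rowK aP.
by rewrite -(eqP Mfree); exact/eqP.
Qed.

Lemma reduced_b0_rep : reduced_b0 R X = n.
Proof.
apply: reduced_H0_dim_unique; apply: xgetPex.
by exists n; exact: reduced_H0_dim_rep.
Qed.

End Representatives.
End ReducedH0.

(** * The presentation *)

Section Restriction.
Variables (R : realType) (m : nat) (K : {set {set 'I_m}}).
Hypothesis K_simplicial : simplicial_complex K.
Implicit Types (i j : 'I_m) (I J : {set 'I_m}).

Lemma restrictionP I J : (I \in restriction K J) = (I \in K) && (I \subset J).
Proof. by rewrite inE. Qed.

Lemma restriction_closed J I I' :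
  I \in restriction K J -> I' \subset I -> I' \in restriction K J.
Proof.
have [_ _ Ksub] := K_simplicial; rewrite !restrictionP => /andP[IK IJ] I'I.
by rewrite (Ksub _ _ IK I'I) (fintype.subset_trans I'I IJ).
Qed.

Lemma restriction_vertex J i : i \in J -> [set i]%SET \in restriction K J.
Proof.
by have [_ Kv _] := K_simplicial; rewrite restrictionP Kv finset.sub1set.
Qed.

Lemma edge_restriction J i j : edge (restriction K J) i j =
  [&& edge K i j, i \in J & j \in J].
Proof.
by rewrite /edge restrictionP finset.subUset !finset.sub1set andbA.
Qed.

Lemma is_max_exists J i : i \in J -> exists k, is_max J k.
Proof.
move=> iJ; case: (@arg_maxnP _ i [pred j in J] (fun j => j : nat) iJ) => k kJ kmax.
exists k; rewrite /is_max [k \in J]kJ /=; apply/forall_inP => j jJ; exact: kmax.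
Qed.

Lemma is_max_unique J i j : is_max J i -> is_max J j -> i = j.
Proof.
move=> /andP[iJ /forall_inP iM] /andP[jJ /forall_inP jM].
by apply/val_inj/eqP; rewrite eqn_leq iM ?jM.
Qed.

Lemma same_component_refl (T : topologicalType) (X : set T) x :
  X x -> same_component R X x x.
Proof. by move=> Xx; exists (cst x); exact: is_path_cst. Qed.

Lemma component_rep_unique J (B : set 'I_m) i j :
  component_representatives R (restriction K J) B -> i \in J -> B i -> B j ->
  same_component R (realization R (restriction K J)) (vertex R i) (vertex R j) ->
  i = j.
Proof.
move=> Brep iJ Bi Bj ij; have Xi := vertex_realization R (restriction_vertex iJ).
have [k [_ uk]] := Brep _ Xi.
rewrite -(uk i) ?(uk j) //; split=> //; exact: same_component_refl.
Qed.

(** The vertex of the maximum serves as root, and the elements of [Th] represent the other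
    components. *)
Lemma reduced_b0_Theta J (Th : {set 'I_m}) : valid_Theta R K J Th ->
  reduced_b0 R (realization R (restriction K J)) = #|Th|.
Proof.
move=> [ThJ Threp]; set X := realization R _.
have VX i : i \in J -> X (vertex R i).
  by move=> iJ; exact: (vertex_realization R (restriction_vertex iJ)).
(* The default 0 occurs only for empty [J], where the realization is empty. *)
pose r : 'rV[R]_m := if [pick i | is_max J i] is Some i then vertex R i else 0%R.
have rE i : is_max J i -> r = vertex R i.
  rewrite /r; case: pickP => [k kM iM|/(_ i)->//].
  by rewrite (is_max_unique kM iM).
have uniq i j : i \in J -> (i \in Th) || is_max J i -> (j \in Th) || is_max J j ->
    same_component R X (vertex R i) (vertex R j) -> i = j.
  by move=> iJ iB jB; exact: (component_rep_unique Threp iJ).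
apply: (@reduced_b0_rep R _ X #|Th| r (fun i : 'I_#|Th| => vertex R (enum_val i))).
- move=> k; have [iJ _] := ThJ _ (enum_valP k); split; last exact: VX.
  have [i iM] := is_max_exists iJ; rewrite (rE i iM); apply: VX.
  by case/andP: iM.
- move=> x Xx; have [i [[/orP[iT|iM] xi] _]] := Threp _ Xx.
    by right; exists (enum_rank_in iT i); rewrite enum_rankK_in.
  by left; rewrite (rE i iM).
- move=> k; have [iJ nM] := ThJ _ (enum_valP k).
  have [i iM] := is_max_exists iJ; rewrite (rE i iM) => ik.
  have iJ' : i \in J by case/andP: iM.
  suff e : i = enum_val k by rewrite -e iM in nM.
  by apply: uniq ik => //; rewrite ?iM ?orbT // (enum_valP k).
- move=> k l kl; apply: enum_val_inj.
  by apply: uniq kl; rewrite ?(enum_valP k) ?(enum_valP l) //;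
    case: (ThJ _ (enum_valP k)).
Qed.

Lemma reduced_letter_card (G : 'I_m -> groupType) (Theta : {set 'I_m} -> {set 'I_m})
    (b : {set 'I_m} -> nat) : (forall J, b J = #|Theta J|) ->
  ([set: reduced_letter G Theta] #=
   [set: {J : {set 'I_m} & ('I_(b J) * gfamily G J)%type}]).
Proof.
move=> /funext ->.
have letterP J (x : 'I_#|Theta J| * gfamily G J) :
    (enum_val x.1 \in Theta J) && supported_on J (val x.2).
  by rewrite enum_valP (valP x.2).
pose F (x : {J : {set 'I_m} & ('I_#|Theta J| * gfamily G J)%type}) :
    reduced_letter G Theta :=
  let: existT J y := x in
  @Sub (raw_letter G) _ (reduced_letter G Theta)
    (enum_val y.1, J, val y.2) (letterP J y).
have Finj : injective F.
  move=> [J [k g]] [J' [k' g']] /(congr1 val) /= [kk JJ' gg]; subst J'.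
  congr existT; congr (_, _); first exact: enum_val_inj.
  exact: val_inj.
have <- : range F = [set: reduced_letter G Theta].
  apply/seteqP; split=> // -[[[i J] g] /= lP] _; have /andP[/= iT gJ] := lP.
  exists (existT _ J (enum_rank_in iT i, Sub g gJ)) => //.
  by apply: val_inj; rewrite /= enum_rankK_in // ?SubK.
by apply: inj_card_eq => x y _ _; exact: Finj.
Qed.

End Restriction.

Lemma fg_ind (X : choiceType) (Q : free_group X -> Prop) : Q 1 ->
  (forall x w, Q w -> Q (fg_gen x * w)) ->
  (forall x w, Q w -> Q ((fg_gen x)^-1 * w)) -> forall w, Q w.
Proof.
move=> Q1 Qg QV w; rewrite -[w]fg_classK; elim: (repr w) => [//|[x b] u IH].
by rewrite fg_class_cons; case: b; [exact: Qg|exact: QV].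
Qed.

(** A cocycle that is the coboundary of [F] along the edges has a telescoping holonomy. *)
Lemma holonomy_telescope (m : nat) (P : groupType) (e : 'I_m -> 'I_m -> P)
    (r : rel 'I_m) (F : 'I_m -> P) i l :
  (forall u v, r u v -> e u v = (F v)^-1 * F u) -> path r i l ->
  holonomy e i l = (F (last i l))^-1 * F i.
Proof.
move=> eF; elim: l i => [|j l IH] i /=.
  by rewrite /holonomy big_nil mulVg.
by move=> /andP[ij /IH]; rewrite holonomy_cons => ->; rewrite eF // -mulgA mulVKg.
Qed.

HB.instance Definition _ (m : nat) (G : 'I_m -> groupType)
    (Theta : {set 'I_m} -> {set 'I_m}) (route : 'I_m -> {set 'I_m} -> seq 'I_m) :=
  UMagmaMorphism.copy (Red (G := G) Theta route) (fg_lift (Red_letter Theta route)).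

(** * Reduction of letters and of cycle relations in terms of holonomy *)

Section Reduction.
Variables (m : nat) (G : 'I_m -> groupType) (K : {set {set 'I_m}}).
Variables (Theta : {set 'I_m} -> {set 'I_m}) (route : 'I_m -> {set 'I_m} -> seq 'I_m).
Hypothesis route_path : forall (J : {set 'I_m}) i, i \in J ->
  path (edge (restriction K J)) i (route i J).
Variables (P : groupType).
Variable phi : UMagmaMorphism.type (free_group (reduced_letter G Theta)) P.
Implicit Types (t : {dffun forall j, G j}) (i j : 'I_m) (J : {set 'I_m}).

(* The image of [Red(L_g(i, J))], where [t] is the extension of [g] by 1 and [J]
   is its support. *)
Definition red_lam i t : P := phi (Red Theta route (L i (fam_supp t) t)).
Definition red_hat i t : P :=
  if i \in Theta (fam_supp t) then phi (Lhat Theta i (fam_supp t) t) else 1.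
Definition red_edge t i j : P :=
  red_lam i (fam_drop t j) * (red_lam j (fam_drop t i))^-1.

Lemma red_lam_id i t : t i = 1 -> red_lam i t = 1.
Proof.
move=> ti; rewrite /red_lam /L insubF; first by rewrite !gmulf1.
by rewrite /= inE ti eqxx.
Qed.

Lemma red_lam_drop i j t :
  phi (Red Theta route (L i (fam_supp t :\ j)%SET t)) = red_lam i (fam_drop t j).
Proof.
rewrite /red_lam fam_supp_drop /L; congr (phi (Red Theta route _)).
suff -> : restrict_family (fam_supp t :\ j)%SET (fam_drop t j) =
  restrict_family (fam_supp t :\ j)%SET t by [].
by apply/ffunP => k; rewrite !ffunE !inE; case: eqVneq.
Qed.

(** The recursion for [Red] multiplies the edge factors in decreasing order, which is the order in
    the holonomy along the route. *)
Lemma red_lam_route i t (J := fam_supp t) : i \in J ->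
  red_lam i t = red_hat (last i (route i J)) t * holonomy (red_edge t) i (route i J).
Proof.
move=> iJ; rewrite /red_lam (Red_L Theta iJ (fam_suppP t) (route_path iJ)) gmulfM.
congr (_ * _); first by rewrite /red_hat; case: ifP => // _; rewrite gmulf1.
rewrite gmulf_prod; apply: eq_bigr => x _.
by rewrite gmulfM gmulfV /red_edge !red_lam_drop.
Qed.

(** The relation multiplies the inverse edge factors in increasing order, hence the inverse of the
    holonomy. *)
Lemma red_cycle b l t : 
  phi (Red Theta route (cycle_relation (b :: l) (fam_supp t) t)) =
  (holonomy (red_edge t) b l)^-1.
Proof.
rewrite /cycle_relation /holonomy -prodgV.
rewrite (gmulf_prod (Red Theta route)) (gmulf_prod phi) /=; apply: eq_bigr => x _.
by rewrite !gmulfM !gmulfV /= /red_edge -!red_lam_drop invgM invgK.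
Qed.

End Reduction.

(** * The edge relation in the presented group, and the isomorphism *)

Section Presentation.
Variables (R : realType) (m : nat) (G : 'I_m -> groupType) (K : {set {set 'I_m}}).
Variables (Theta : {set 'I_m} -> {set 'I_m}) (route : 'I_m -> {set 'I_m} -> seq 'I_m).
Variable Gen : {set 'I_m} -> set (seq 'I_m).
Hypothesis K_simplicial : simplicial_complex K.
Hypothesis Theta_valid : forall J, valid_Theta R K J (Theta J).
Hypothesis route_valid : forall (J : {set 'I_m}) i, i \in J ->
  valid_route K J (Theta J) i (route i J).
Hypothesis Gen_cycle : forall J s, Gen J s -> is_cycle (restriction K J) s.
Hypothesis Gen_Pi1 : forall J, generates_Pi1 R (restriction K J) (Gen J).
Implicit Types (t : {dffun forall j, G j}) (i j : 'I_m) (J : {set 'I_m}).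

Local Notation reprs J := [set i | (i \in Theta J) || is_max J i].
Local Notation hat := (reduced_letter G Theta).

Let route_path J i : i \in J -> path (edge (restriction K J)) i (route i J).
Proof. by move=> /route_valid[]. Qed.

Lemma path_restriction J i l : i \in J -> path (edge (restriction K J)) i l ->
  is_path (realization R (restriction K J)) (edge_path R i l)
    (vertex R i) (vertex R (last i l)).
Proof.
move=> iJ; apply: is_path_edge_path (restriction_vertex K_simplicial iJ).
by move=> I I'; exact: restriction_closed.
Qed.

Lemma last_route_unique J i j : i \in J -> j \in J ->
  same_component R (realization R (restriction K J)) (vertex R i) (vertex R j) ->
  last i (route i J) = last j (route j J).
Proof.
move=> iJ jJ ij; have [ip irep _] := route_valid iJ; have [jp jrep _] := route_valid jJ.
have [_ Brep] := Theta_valid J.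
have lastJ k l : k \in J -> path (edge (restriction K J)) k l -> last k l \in J.
  elim: l k => //= k' l IH k kJ /andP[+ ]; rewrite edge_restriction => /and3P[_ _].
  exact: IH.
apply: (component_rep_unique K_simplicial Brep) => //; first exact: lastJ.
apply: (same_component_trans (y := vertex R i)).
  by apply: same_component_sym; eexists; exact: path_restriction ip.
by apply: same_component_trans ij _; eexists; exact: path_restriction jp.
Qed.

Lemma route_rep J i : i \in J -> (i \in Theta J) || is_max J i -> route i J = [::].
Proof.
move=> iJ irep; have [ip lrep e] := route_valid iJ; apply: e.
have [_ Brep] := Theta_valid J.
apply: (component_rep_unique K_simplicial Brep) => //.
by eexists; exact: path_restriction ip.
Qed.

Section Morphism.
Variables (P : groupType) (phi : UMagmaMorphism.type (free_group hat) P).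
Local Notation lam := (red_lam route phi).
Local Notation e := (red_edge route phi).

Lemma red_lam_rep i t : (i \in Theta (fam_supp t)) || is_max (fam_supp t) i ->
  lam i t = red_hat phi i t.
Proof.
move=> irep; have iJ : i \in fam_supp t.
  case/orP: (irep) => [/(Theta_valid _).1[]//|/andP[]//].
rewrite (red_lam_route route_path) // (route_rep iJ irep) /=.
by rewrite /holonomy big_nil mulg1.
Qed.

Lemma red_lam_Theta (l : hat) : lam (val l).1.1 (val l).2 = phi (fg_gen l).
Proof.
case: l => -[[i J] t] lP /=; have /andP[/= iT tJ] := lP.
have eJ := supported_fam_supp tJ.
rewrite red_lam_rep ?eJ ?iT // /red_hat eJ iT /Lhat restrict_family_id //.
by rewrite insubT.
Qed.

(** If [t i] is nontrivial, [i] is the maximum of the support: its route is empty and it is not in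
    [Theta]. *)
Lemma red_lam_last i t : (forall j, (i < j)%N -> t j = 1) -> lam i t = 1.
Proof.
move=> ti; have [ti1|ti1] := eqVneq (t i) 1; first exact: red_lam_id.
have iM : is_max (fam_supp t) i.
  rewrite /is_max inE ti1 /=; apply/forall_inP => j; rewrite inE.
  by apply: contraNT; rewrite -ltnNge => /ti ->.
rewrite red_lam_rep ?iM ?orbT // /red_hat; case: ifP => //.
by move=> /(Theta_valid _).1[_]; rewrite iM.
Qed.

End Morphism.

Let f : UMagmaMorphism.type (free_group hat) (graph_product G K) :=
  fg_lift (reduced_letter_elt K).

Lemma red_hat_graph_product i t :
  (i \in Theta (fam_supp t)) || is_max (fam_supp t) i -> red_hat f i t = fam_L K i t.
Proof.
move=> irep; rewrite /red_hat; case: ifPn irep => [iT _|_ /= /andP[_ /forall_inP iM]].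
  rewrite /Lhat restrict_family_id ?fam_suppP // insubT /= ?iT ?fam_suppP // => lP.
  by rewrite [LHS]fg_lift_gen /reduced_letter_elt /= L_eltE ?fam_suppP.
rewrite fam_L_last // => j ij; apply/eqP; apply: contraTT ij => tj.
by rewrite -leqNgt; apply: iM; rewrite inE.
Qed.

Lemma card_fam_supp_drop t i : i \in fam_supp t ->
  (#|fam_supp (fam_drop t i)| < #|fam_supp t|)%N.
Proof. by move=> it; rewrite fam_supp_drop (cardsD1 i (fam_supp t)) it. Qed.

(** The edge relation, rewritten to exhibit the edge factor as a coboundary. *)
Lemma edge_quotient (P : groupType) (l : 'I_m -> {dffun forall j, G j} -> P) t u v :
  l u t * l v (fam_drop t u) = l v t * l u (fam_drop t v) ->
  l u (fam_drop t v) * (l v (fam_drop t u))^-1 = (l v t)^-1 * l u t.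
Proof.
move=> luv; apply: (@mulgI _ (l v t)).
by rewrite mulgA -luv mulgK mulVKg.
Qed.

(** By induction on the support the edge factors are the coboundary of [fam_L], so the holonomy
    along the route telescopes; its remaining factor at the representative cancels against
    [red_hat]. *)
Lemma red_lam_graph_product i t : red_lam route f i t = fam_L K i t.
Proof.
have [n] := ubnP #|fam_supp t|; elim: n i t => // n IH i t tn.
have [ti1|ti1] := eqVneq (t i) 1.
  rewrite red_lam_id // /fam_L ti1 gp_in1 invg1 mulg1.
  suff -> : fam_drop t i = t by rewrite mulgV.
  by apply/ffunP => k; rewrite ffunE; case: eqVneq => // ->.
have iJ : i \in fam_supp t by rewrite inE.
have [_ lrep _] := route_valid iJ.
rewrite (red_lam_route route_path) // red_hat_graph_product //.
rewrite (holonomy_telescope (F := fun u => fam_L K u t) _ (route_path iJ)) ?mulVKg //.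
move=> u v; rewrite edge_restriction => /and3P[uv uJ vJ].
rewrite /red_edge !IH.
- exact/edge_quotient/fam_L_edge.
- exact: leq_trans (card_fam_supp_drop uJ) _.
- exact: leq_trans (card_fam_supp_drop vJ) _.
Qed.

Let rels := range (reduced_relation (G := G) (Theta := Theta) route Gen).
Let pi : UMagmaMorphism.type (free_group hat) (quot_group rels) := quot_proj rels.

Lemma reduced_relation_graph_product r : rels r -> f r = 1.
Proof.
move=> [[J [s g]] _ <-] /=; case: s g => s sG [t tJ].
have := Gen_cycle (set_mem sG) => /=; case: s sG => //= b l sG /and3P[bJ lP /eqP lb].
have eJ := supported_fam_supp tJ.
rewrite -{1}eJ red_cycle (holonomy_telescope (F := fun u => fam_L K u t) _ lP).
  by rewrite lb mulVg invg1.
move=> u v; rewrite edge_restriction => /and3P[uv uJ vJ].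
rewrite /red_edge !red_lam_graph_product.
exact/edge_quotient/fam_L_edge.
Qed.

Lemma quot_red_lam_edge i j t : edge K i j ->
  red_lam route pi i t * red_lam route pi j (fam_drop t i) =
  red_lam route pi j t * red_lam route pi i (fam_drop t j).
Proof.
set lam := red_lam route pi.
have [n] := ubnP #|fam_supp t|; elim: n i j t => // n IH i j t tn ij.
have drop1 (k : 'I_m) : t k = 1 -> fam_drop t k = t.
  by move=> tk; apply/ffunP => k'; rewrite ffunE; case: eqVneq => // ->.
have [ti1|ti1] := eqVneq (t i) 1.
  by rewrite drop1 // /lam !(red_lam_id _ _ (i := i)) ?mul1g ?mulg1 // ffunE ti1
    if_same.
have [tj1|tj1] := eqVneq (t j) 1.
  by rewrite (drop1 j) // /lam !(red_lam_id _ _ (i := j)) ?mul1g ?mulg1 // ffunE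
    tj1 if_same.
set J := fam_supp t; pose e := red_edge route pi t.
have iJ : i \in J by rewrite inE.
have jJ : j \in J by rewrite inE.
have ee u : e u u = 1 by rewrite /e /red_edge mulgV.
have eV u v : e u v = (e v u)^-1 by rewrite /e /red_edge invgM invgK.
have IHd u v w : w \in J -> edge K u v ->
    lam u (fam_drop t w) * lam v (fam_drop (fam_drop t w) u) =
    lam v (fam_drop t w) * lam u (fam_drop (fam_drop t w) v).
  by move=> wJ; apply: IH; exact: leq_trans (card_fam_supp_drop wJ) _.
(* Once coinciding vertices are excluded, the identity on a triangle follows from the induction
   hypothesis for each edge, with the opposite vertex dropped from [t]. *)
have e_cocycle (I : {set 'I_m}) u v w : I \in restriction K J ->
    u \in I -> v \in I -> w \in I -> e u w = e v w * e u v.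
  move=> IK uI vI wI.
  have [->|uv] := eqVneq u v; first by rewrite ee mulg1.
  have [->|vw] := eqVneq v w; first by rewrite ee mul1g.
  have [->|uw] := eqVneq u w; first by rewrite ee (eV v w) mulVg.
  have eI x y : x \in I -> y \in I -> x != y -> edge K x y.
    move=> xI yI xy; rewrite /edge xy.
    have : [set x; y]%SET \in restriction K J.
      apply: restriction_closed IK _ => //.
      by rewrite finset.subUset !finset.sub1set xI.
    by rewrite restrictionP => /andP[].
  have IJ x : x \in I -> x \in J.
    by move: IK; rewrite restrictionP => /andP[_ /fintype.subsetP]; exact.
  have h1 := IHd w u v (IJ _ vI) (eI _ _ wI uI _).
  have h2 := IHd v u w (IJ _ wI) (eI _ _ vI uI _).
  have h3 := IHd v w u (IJ _ uI) (eI _ _ vI wI _).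
  rewrite /e /red_edge -/lam.
  have {}h1 : (lam w (fam_drop t v))^-1 * lam u (fam_drop t v) =
      lam u (fam_drop (fam_drop t w) v) * (lam w (fam_drop (fam_drop t u) v))^-1.
    apply: (@mulgI _ (lam w (fam_drop t v))); rewrite mulVKg mulgA.
    by rewrite (fam_dropC t w v) (fam_dropC t u v) h1 1?eq_sym // mulgK.
  rewrite mulgA -(mulgA (lam v (fam_drop t w))) h1 mulgA h2 //; last by rewrite eq_sym.
  rewrite -!mulgA; congr (_ * _).
  by rewrite -!invgM h3 // invgM (fam_dropC t u w) mulVKg.
have K_closed := @restriction_closed _ _ K_simplicial J.
have iK := restriction_vertex K_simplicial iJ.
have jK := restriction_vertex K_simplicial jJ.
have ijK x y : x \in J -> y \in J -> edge K x y ->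
    [set x; y]%SET \in restriction K J.
  by move=> xJ yJ xy; have := edge_restriction K J x y; rewrite xy xJ yJ => /andP[].
have ji : edge K j i by move: ij; rewrite /edge eq_sym finset.setUC.
have last_ij : last j (route j J) = last i (route i J).
  apply: last_route_unique => //; eexists; exact: is_path_segment (ijK _ _ jJ iJ ji).
have pathT := transport_edge_path R e_cocycle K_closed.
(* The starting value over [j] is chosen so that its transport to the common representative is the
   endpoint of the route from [i] started at 1. *)
have /transport_inv Tj := pathT _ _ ((holonomy e j (route j J))^-1 *
  holonomy e i (route i J)) jK (route_path jJ).
have Ti := pathT _ _ 1 iK (route_path iJ).
rewrite mulVKg last_ij in Tj; rewrite mulg1 in Ti.
have loopT := transport_cat Ti (transport_cat Tj
  (transport_segment R e_cocycle _ (ijK _ _ jJ iJ ji))).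
have Pj := is_path_inv (path_restriction jJ (route_path jJ)); rewrite last_ij in Pj.
have loopP := is_path_cat (path_restriction iJ (route_path iJ))
  (is_path_cat Pj (is_path_segment R K_closed (ijK _ _ jJ iJ ji))).
have := generates_Pi1_transport e_cocycle K_closed (Gen_Pi1 J) (@Gen_cycle J) _
  loopP loopT.
have hol_gen b l : Gen J (b :: l) -> holonomy e b l = 1.
  move=> Gbl; apply: invg_inj; rewrite invg1 -red_cycle.
  apply/quot_proj_eq1/ncl_gen.
  by exists (existT _ J (SigSub (mem_set Gbl), Sub t (fam_suppP t))).
move=> /(_ hol_gen); rewrite (eV j i) => /mulg1_eq; rewrite invgK => hol_ij.
have -> : lam i (fam_drop t j) = (holonomy e j (route j J))^-1 *
    holonomy e i (route i J) * lam j (fam_drop t i).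
  by rewrite -hol_ij /e /red_edge mulgVK.
(* Both sides are now the same [red_hat], times the holonomy of the route from [i], times
   [lam j (fam_drop t i)]. *)
rewrite /lam !(red_lam_route route_path _ iJ) !(red_lam_route route_path _ jJ) last_ij.
by rewrite -!mulgA mulVKg.
Qed.

Lemma presented_by_Theta :
  presented_by (Cart G K) (reduced_letter_elt (Theta := Theta) K) rels.
Proof.
have [fb fbE] := quot_universal reduced_relation_graph_product.
have fb_lam i t : fb (red_lam route pi i t) = fam_L K i t.
  by rewrite fbE; exact: red_lam_graph_product.
have lam_last := red_lam_last pi.
have lam_id i t : t i = 1 -> red_lam route pi i t = 1 by exact: red_lam_id.
have [psi [psi1 psiM]] := lam_section lam_last lam_id quot_red_lam_edge.
have letterE (l : hat) : reduced_letter_elt K l = fam_L K (val l).1.1 (val l).2.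
  by case: l => -[[i J] t] /= lP; have /andP[_ tJ] := lP; exact: L_eltE.
have f1 : f 1 = 1 by exact: gmulf1.
have fM w w' : f (w * w') = f w * f w' by exact: gmulfM.
have fV w : f w^-1 = (f w)^-1 by exact: gmulfV.
have f_gen (l : hat) : f (fg_gen l) = fam_L K (val l).1.1 (val l).2.
  by rewrite -letterE; exact: fg_lift_gen.
split; apply/seteqP; split.
- move=> _ [w _ <-]; apply/Cart_proj => k; rewrite -/(f w).
  have Lk (l : hat) : gp_proj k (f (fg_gen l)) = 1.
    by rewrite f_gen; move: k; apply/Cart_proj; exact: fam_L_Cart.
  elim/fg_ind: w => [|l w IH|l w IH]; first by rewrite f1 gmulf1.
    by rewrite fM gmulfM /= Lk IH mulg1.
  by rewrite fM fV gmulfM gmulfV /= Lk IH invg1 mulg1.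
- move=> w /(Cart_lam quot_red_lam_edge fb_lam)[p ->].
  exists (repr p) => //; rewrite -[in RHS](quot_projK p); exact/esym/fbE.
(* The factor [y] is what lets the induction peel letters off [w] from the left; for [y = 1] and
   [f w = 1] this gives [pi w = 1]. *)
- move=> w /= fw; have psi_f y : psi (f w * y) = pi w * psi y.
    have psi_gen (l : hat) z : psi (f (fg_gen l) * z) = pi (fg_gen l) * psi z.
      by rewrite f_gen psiM (red_lam_Theta pi l).
    elim/fg_ind: w {fw} y => [y|l w IH y|l w IH y].
    - by rewrite f1 mul1g gmulf1 mul1g.
    - by rewrite fM -mulgA psi_gen IH gmulfM mulgA.
    - rewrite fM fV gmulfM gmulfV -!mulgA -IH; apply: (@mulgI _ (pi (fg_gen l))).
      by rewrite mulVKg -psi_gen mulVKg.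
  have := psi_f 1; rewrite [f w]fw !mulg1 psi1 mulg1 => /esym.
  by move=> /quot_proj_eq1.
- move=> w wR /=; rewrite -[LHS]fbE.
  by have /quot_proj_eq1 -> := wR; rewrite gmulf1.
Qed.

End Presentation.

Local Close Scope group_scope.

Theorem theorem4p11 (R : realType) (m : nat) (G : 'I_m -> groupType)
    (K : {set {set 'I_m}}) (Theta : {set 'I_m} -> {set 'I_m})
    (route : 'I_m -> {set 'I_m} -> seq 'I_m)
    (Gen : {set 'I_m} -> set (seq 'I_m)) :
  simplicial_complex K -> flag_complex K ->
  (forall J, valid_Theta R K J (Theta J)) ->
  (forall (J : {set 'I_m}) i, i \in J ->
     valid_route K J (Theta J) i (route i J)) ->
  (forall J s, Gen J s -> is_cycle (restriction K J) s) ->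
  (forall J, generates_Pi1 R (restriction K J) (Gen J)) ->
  [set: reduced_letter G Theta] #=
    [set: {J : {set 'I_m} &
            ('I_(reduced_b0 R (realization R (restriction K J))) *
             gfamily G J)%type}] /\
  presented_by (Cart G K) (reduced_letter_elt (Theta := Theta) K)
    (range (reduced_relation (Theta := Theta) route Gen)).
Proof.
move=> Ks _ Th Rt Gc GP; split; last exact: (presented_by_Theta G Ks Th Rt Gc GP).
by apply: reduced_letter_card => J; exact: reduced_b0_Theta.
Qed.
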